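(* Let $(U_n)$ be the signal process and $\{V_n^{(k)}\}_{k=1}^K$ the EnKF ensemble process described in the context, with observation matrix $H\in\mathbb{R}^{q\times d}$, $\mathrm{rank}(H)=q\le d$. Assume that the signal satisfies the observable energy criterion: there exist $\beta_h\in(0,1)$ and $K_h>0$ such that $$|H\Psi_h(u)|^2+\mathrm{tr}(HR_h(u)H^T)\le (1-\beta_h)|Hu|^2+K_h\qquad\text{for all }u\in\mathbb{R}^d .$$ Then: (i) There exist constants $D,M>0$ such that $$\mathbb{E}_{n-1}\big(|HV^{(k)}_{n}|^2+M|HU_n|^2\big)\le \big(1-\tfrac12\beta_h\big)\big(|HV^{(k)}_{n-1}|^2+M|HU_{n-1}|^2\big)+D$$ for each $k=1,\dots,K$ and uniformly in $n\ge 1$. In particular, the function $$\mathcal{E}(U,V^{(1)},\dots,V^{(K)})=\sum_{k=1}^K|HV^{(k)}|^2+KM|HU|^2$$ is a Lyapunov function for the Markov chain $(U_n,V_n^{(1)},\dots,V_n^{(K)})$, and hence the signal-ensemble process is $\mathcal{E}$-bounded. (ii) When $\mathrm{rank}(H)=q=d$, $\mathcal{E}$ is a strong Lyapunov function and $$\mathbb{E}|U_n|^2+\sum_{k=1}^K\mathbb{E}|V_n^{(k)}|^2$$ is bounded uniformly in $n\ge0$. The precise upper bound can be read off from the Grönwall bound for Lyapunov functions recalled in the context. (iii) All the claims above hold for any positive semi-definite choice of $\widehat C_n$ in the analysis step; in particular they hold for additive covariance inflation ($\widehat C_n$ replaced by $\widehat C_n+\lambda I$, $\lambda>0$) and uniform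 covariance inflation ($\widehat C_n$ replaced by $(1+\lambda)\widehat C_n$, $\lambda>0$).
   Context: Signal and observations. Fix $h>0$, integers $1\le q\le d$, $K\ge2$, and $H\in\mathbb{R}^{q\times d}$ of rank $q$. $\Psi_h:\mathbb{R}^d\to\mathbb{R}^d$ is a (nonlinear) map. The signal in $\mathbb{R}^d$ and observation in $\mathbb{R}^q$ are $$U_n=\Psi_h(U_{n-1})+\zeta_n,\qquad Z_n=HU_n+\xi_n .$$ Given the past up to time $n-1$, the law of $\zeta_n$ depends only on $U_{n-1}$; given $U_{n-1}=u$ it has mean $0$ and covariance matrix $R_h(u)$. The $\xi_n$ are i.i.d. noises with mean $0$ and covariance $I_q$, independent of the signal. EnKF. The initial ensemble is, for instance, sampled from the equilibrium measure of $U_n$. Given the ensemble $\{V_{n-1}^{(k)}\}_{k=1}^K\subset\mathbb{R}^d$: Forecast: $\widehat V_n^{(k)}=\Psi_h(V_{n-1}^{(k)})+\zeta_n^{(k)}$, where the $\zeta_n^{(k)}$ are independent samples of the system noise, $\zeta_n^{(k)}$ having the conditional law that $\zeta_n$ has given $U_{n-1}=V_{n-1}^{(k)}$. Put $\overline{\widehat V}_n=\frac1K\sum_k\widehat V_n^{(k)}$ and $\widehat C_n=\frac1{K-1}\sum_k(\widehat V_n^{(k)}-\overline{\widehat V}_n)(\widehat V_n^{(k)}-\overline{\widehat V}_n)^T$. Analysis: $Z_n^{(k)}=Z_n+\xi_n^{(k)}$, with $\xi_n^{(k)}$ independent samples distributed as $\xi_n$, and $$V_n^{(k)}=\widehat V_n^{(k)}-\widehat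 C_nH^T(I+H\widehat C_nH^T)^{-1}(H\widehat V_n^{(k)}-Z_n^{(k)}).$$ The process $(U_n,V_n^{(1)},\dots,V_n^{(K)})$ is a Markov chain; $\mathcal{F}_n=\sigma\{U_m,V_m^{(1)},\dots,V_m^{(K)}:m\le n\}$ and $\mathbb{E}_n$ is conditional expectation given $\mathcal{F}_n$. Lyapunov functions. A function $\mathcal{E}\ge0$ is a Lyapunov function for a Markov chain $X_n$ if there are constants $\beta\in(0,1)$, $c>0$ with $\mathbb{E}(\mathcal{E}(X_n)\mid X_{n-1})\le(1-\beta)\mathcal{E}(X_{n-1})+c$ for all integers $n\ge1$. It is strong if its sub-level sets are compact. By Grönwall's inequality a Lyapunov function satisfies $\mathbb{E}\mathcal{E}(X_n)\le(1-\beta)^n\mathbb{E}\mathcal{E}(X_0)+c/\beta$, so $\mathbb{E}\mathcal{E}(X_n)$ can be bounded uniformly in time; in this case $X_n$ is called $\mathcal{E}$-bounded. *)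

(* Defs.v *)
From HB Require Import structures.
From mathcomp Require Import all_boot all_order all_algebra.
From mathcomp Require Import all_classical all_reals all_analysis.
From mathcomp Require Import measurable_realfun.

Set Implicit Arguments.
Unset Strict Implicit.
Unset Printing Implicit Defensive.

Import Order.TTheory GRing.Theory Num.Theory.
Import numFieldNormedType.Exports.

Local Open Scope classical_set_scope.
Local Open Scope ring_scope.

(* Matrices carry the sigma-algebra generated by their entries; over the reals
   this is the Borel sigma-algebra of the finite-dimensional space.  Together
   with the product structure of the library it makes 'cV[R]_d and the state
   space below measurable types. *)
Definition mx_sigma_algebra d (T : measurableType d) (m n : nat) :
    set (set 'M[T]_(m, n)) :=
  <<s \bigcup_(ij in [set: 'I_m * 'I_n])
        g_sigma_algebra_preimage (fun A : 'M[T]_(m, n) => A ij.1 ij.2) >>.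

Fact measure_mx_display : measure_display -> measure_display.
Proof. by []. Qed.

Section measurable_matrix.
Context d (T : measurableType d) (m n : nat).

Let mx_set0 : @mx_sigma_algebra d T m n set0.
Proof. exact: sigma_algebra0. Qed.

Let mx_setC A : @mx_sigma_algebra d T m n A -> @mx_sigma_algebra d T m n (~` A).
Proof. exact: sigma_algebraC. Qed.

Let mx_bigcup (F : (set 'M[T]_(m, n))^nat) :
  (forall i, @mx_sigma_algebra d T m n (F i)) ->
  @mx_sigma_algebra d T m n (\bigcup_i F i).
Proof. exact: sigma_algebra_bigcup. Qed.

HB.instance Definition _ := @isMeasurable.Build (measure_mx_display d)
  'M[T]_(m, n) (@mx_sigma_algebra d T m n) mx_set0 mx_setC mx_bigcup.

End measurable_matrix.

(* Squared Euclidean norm; the norm `|x| that the library puts on matrices is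
   the maximum norm. *)
Definition sqnorm (R : realType) n (x : 'cV[R]_n) : R :=
  \sum_(i < n) x i 0 ^+ 2.

Definition psdmx (R : realType) n (A : 'M[R]_n) : Prop :=
  A^T = A /\ forall x : 'cV[R]_n, 0 <= (x^T *m A *m x) 0 0.

(* Square integrability makes the integrals of the last two clauses those of
   integrable functions. *)
Definition has_mean_cov (R : realType) n (mu : {measure set 'cV[R]_n -> \bar R})
    (m : 'cV[R]_n) (S : 'M[R]_n) : Prop :=
  [/\ forall i, mu.-integrable setT (fun x => (x i 0 ^+ 2)%:E),
      forall i, (\int[mu]_x (x i 0)%:E = (m i 0)%:E)%E &
      forall i j,
        (\int[mu]_x ((x i 0 - m i 0) * (x j 0 - m j 0))%:E = (S i j)%:E)%E].

Definition observable_energy_criterion (R : realType) d q (H : 'M[R]_(q, d))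
    (Psi : 'cV[R]_d -> 'cV[R]_d) (Rcov : 'cV[R]_d -> 'M[R]_d) (beta k : R) :=
  forall u, sqnorm (H *m Psi u) + \tr (H *m Rcov u *m H^T)
            <= (1 - beta) * sqnorm (H *m u) + k.

Section conditional_expectation.
Context d0 (Omega : measurableType d0) (R : realType) (P : probability Omega R).

(* W is a version of the conditional expectation of the [0, +oo]-valued
   variable Y given the sub-sigma-algebra G; no integrability is needed. *)
Definition is_cond_expectation (G : set (set Omega)) (Y W : Omega -> \bar R) :=
  [/\ forall w, (0 <= W w)%E,
      forall B : set (\bar R), measurable B -> G (W @^-1` B) &
      forall A, G A -> (\int[P]_(w in A) W w = \int[P]_(w in A) Y w)%E].

(* The default value +oo would make every upper bound below fail if there were
   no version. *)
Definition cond_expectation (G : set (set Omega)) (Y : Omega -> \bar R) :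
    Omega -> \bar R :=
  xget (cst +oo%E) [set W | is_cond_expectation G Y W].

Definition natural_filtration d1 (T : measurableType d1)
    (X : nat -> Omega -> T) (n : nat) : set (set Omega) :=
  <<s \bigcup_(m in [set m | (m <= n)%N]) g_sigma_algebra_preimage (X m) >>.

(* Generated by the states X up to time n and the noises N of times 1 to n. *)
Definition past d1 d2 (T1 : measurableType d1) (T2 : measurableType d2)
    (X : nat -> Omega -> T1) (N : nat -> Omega -> T2) (n : nat) :
    set (set Omega) :=
  <<s natural_filtration X n
      `|` \bigcup_(m in [set m | (0 < m <= n)%N])
            g_sigma_algebra_preimage (N m) >>.

Definition lyapunov_function d1 (T : measurableType d1)
    (X : nat -> Omega -> T) (E : T -> R) : Prop :=
  (forall x, 0 <= E x) /\
  exists beta c : R, [/\ 0 < beta < 1, 0 < c &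
    forall n, {ae P, forall w,
      (cond_expectation (g_sigma_algebra_preimage (X n))
         (fun w' => (E (X n.+1 w'))%:E) w
       <= ((1 - beta) * E (X n w) + c)%:E)%E}].

Definition mean_value T (X : nat -> Omega -> T) (E : T -> R) (n : nat) :
    \bar R :=
  'E_P[E \o X n].

Definition bounded_in_mean T (X : nat -> Omega -> T) (E : T -> R) : Prop :=
  exists B : R, forall n, (mean_value X E n <= B%:E)%E.

End conditional_expectation.

(* An ensemble of K vectors of R^d is the matrix whose k-th column is the k-th
   member.  A state of the signal-ensemble process is the pair (signal,
   ensemble), in the product 'cV[R]_d * 'M[R]_(d, K). *)
Definition strong_lyapunov_function d0 (Omega : measurableType d0)
    (R : realType) (P : probability Omega R) d K
    (X : nat -> Omega -> 'cV[R]_d * 'M[R]_(d, K))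
    (E : 'cV[R]_d * 'M[R]_(d, K) -> R) : Prop :=
  lyapunov_function P X E /\ forall a : R, compact [set x | E x <= a].

Definition energy (R : realType) d q K (H : 'M[R]_(q, d)) (M : R)
    (x : 'cV[R]_d * 'M[R]_(d, K)) : R :=
  \sum_(k < K) sqnorm (H *m col k x.2) + K%:R * M * sqnorm (H *m x.1).

Definition total_square (R : realType) d K (x : 'cV[R]_d * 'M[R]_(d, K)) : R :=
  sqnorm x.1 + \sum_(k < K) sqnorm (col k x.2).

Definition ensemble_mean (R : realType) d K (W : 'M[R]_(d, K)) : 'cV[R]_d :=
  K%:R^-1 *: \sum_(k < K) col k W.

Definition sample_cov (R : realType) d K (W : 'M[R]_(d, K)) : 'M[R]_d :=
  (K.-1)%:R^-1 *: \sum_(k < K)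
    ((col k W - ensemble_mean W) *m (col k W - ensemble_mean W)^T).

Definition kalman_gain (R : realType) d q (H : 'M[R]_(q, d)) (C : 'M[R]_d) :
    'M[R]_(d, q) :=
  C *m H^T *m invmx (1%:M + H *m C *m H^T).

(* How the matrix used in the analysis step at time n may be chosen, given the
   forecast ensemble W.  As a relation it also allows random choices. *)
Definition cov_choice (R : realType) (d K : nat) : Type :=
  nat -> 'M[R]_(d, K) -> 'M[R]_d -> Prop.

Definition sample_choice {R : realType} {d K} : cov_choice R d K :=
  fun _ W C => C = sample_cov W.

Definition additive_inflation {R : realType} {d K} (lambda : R) :
    cov_choice R d K :=
  fun _ W C => C = sample_cov W + lambda%:M.

Definition uniform_inflation {R : realType} {d K} (lambda : R) :
    cov_choice R d K :=
  fun _ W C => C = (1 + lambda) *: sample_cov W.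

Definition psd_choice (R : realType) d K (choice : cov_choice R d K) : Prop :=
  forall n W C, choice n W C -> psdmx C.

(* A joint realization of signal, observations and ensemble.  The values at
   time 0 of the noises, the observation, the forecast and the analysis
   covariance play no role.  Q n u is the law of the system noise at time n
   when the preceding signal (or ensemble member) is u; only its mean and
   covariance are required not to depend on n.  nu is the law of the
   observational noise. *)
Record enkf d0 (Omega : measurableType d0) (R : realType)
    (P : probability Omega R) (d q K : nat) (H : 'M[R]_(q, d))
    (Psi : {mfun 'cV[R]_d >-> 'cV[R]_d})
    (Q : nat -> R.-pker 'cV[R]_d ~> 'cV[R]_d) (nu : probability 'cV[R]_q R)
    (choice : cov_choice R d K) := Enkf {
  signal : nat -> {RV P >-> 'cV[R]_d};
  observation : nat -> {RV P >-> 'cV[R]_q};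
  forecast : nat -> {RV P >-> 'M[R]_(d, K)};
  ensemble : nat -> {RV P >-> 'M[R]_(d, K)};
  analysis_cov : nat -> {RV P >-> 'M[R]_d};
  zeta : nat -> {RV P >-> 'cV[R]_d};
  xi : nat -> {RV P >-> 'cV[R]_q};
  ens_zeta : nat -> {RV P >-> 'M[R]_(d, K)};
  ens_xi : nat -> {RV P >-> 'M[R]_(q, K)};
  signalE : forall n w, signal n.+1 w = Psi (signal n w) + zeta n.+1 w;
  observationE : forall n w,
    observation n.+1 w = H *m signal n.+1 w + xi n.+1 w;
  forecastE : forall n w k,
    col k (forecast n.+1 w)
    = Psi (col k (ensemble n w)) + col k (ens_zeta n.+1 w);
  analysis_covP : forall n w,
    choice n.+1 (forecast n.+1 w) (analysis_cov n.+1 w);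
  ensembleE : forall n w k,
    col k (ensemble n.+1 w)
    = col k (forecast n.+1 w)
      - kalman_gain H (analysis_cov n.+1 w)
        *m (H *m col k (forecast n.+1 w)
            - (observation n.+1 w + col k (ens_xi n.+1 w)));
  (* Given the past, the 2K + 2 noises of time n + 1 are independent, with the
     stated conditional laws. *)
  noise_law : forall n A (B : set 'cV[R]_d) (C : set 'cV[R]_q)
      (Bk : 'I_K -> set 'cV[R]_d) (Ck : 'I_K -> set 'cV[R]_q),
    past (fun m w => (signal m w, ensemble m w))
      (fun m w => (zeta m w, xi m w, ens_zeta m w, ens_xi m w)) n A ->
    measurable B -> measurable C ->
    (forall k, measurable (Bk k)) -> (forall k, measurable (Ck k)) ->
    (P [set w | [/\ A w, B (zeta n.+1 w), C (xi n.+1 w),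
                    forall k, Bk k (col k (ens_zeta n.+1 w)) &
                    forall k, Ck k (col k (ens_xi n.+1 w))]]
     = \int[P]_(w in A)
         (Q n.+1 (signal n w) B * nu C
          * \prod_(k < K) Q n.+1 (col k (ensemble n w)) (Bk k)
          * \prod_(k < K) nu (Ck k)))%E
}.

Definition chain d0 (Omega : measurableType d0) (R : realType)
    (P : probability Omega R) (d q K : nat) (H : 'M[R]_(q, d))
    (Psi : {mfun 'cV[R]_d >-> 'cV[R]_d})
    (Q : nat -> R.-pker 'cV[R]_d ~> 'cV[R]_d) (nu : probability 'cV[R]_q R)
    (choice : cov_choice R d K) (X : enkf P H Psi Q nu choice)
    (n : nat) (w : Omega) : 'cV[R]_d * 'M[R]_(d, K) :=
  (signal X n w, ensemble X n w).

Section stability.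
Context d0 (Omega : measurableType d0) (R : realType) (P : probability Omega R).
Context (d q K : nat) (H : 'M[R]_(q, d)) (Psi : {mfun 'cV[R]_d >-> 'cV[R]_d}).
Context (Q : nat -> R.-pker 'cV[R]_d ~> 'cV[R]_d) (nu : probability 'cV[R]_q R).
Context (choice : cov_choice R d K) (X : enkf P H Psi Q nu choice).

(* Boundedness uniformly in time presupposes a finite initial mean; the initial
   law is otherwise arbitrary. *)
Definition observable_stability (beta D M : R) : Prop :=
  [/\ forall n (k : 'I_K), {ae P, forall w,
        (cond_expectation P (natural_filtration (chain X) n)
           (fun w' => (sqnorm (H *m col k (ensemble X n.+1 w'))
                       + M * sqnorm (H *m signal X n.+1 w'))%:E) w
         <= ((1 - beta / 2) * (sqnorm (H *m col k (ensemble X n w))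
                               + M * sqnorm (H *m signal X n w)) + D)%:E)%E},
      lyapunov_function P (chain X) (energy H M) &
      (mean_value P (chain X) (energy H M) 0 < +oo)%E ->
        bounded_in_mean P (chain X) (energy H M)].

(* By summation over k, the one-step bound gives the Lyapunov inequality of
   energy H M with constants beta / 2 and K * D, whence the middle bound. *)
Definition full_stability (beta D M kappa : R) : Prop :=
  [/\ strong_lyapunov_function P (chain X) (energy H M),
      forall n, (mean_value P (chain X) (@total_square R d K) n
        <= kappa%:E * (((1 - beta / 2) ^+ n)%:E
                         * mean_value P (chain X) (energy H M) 0
                       + (K%:R * D / (beta / 2))%:E))%E &
      (mean_value P (chain X) (@total_square R d K) 0 < +oo)%E ->
        bounded_in_mean P (chain X) (@total_square R d K)].

End stability.

(* The constants depend on the model and on the choice of the analysis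
   covariance, not on the realization (in particular not on the initial law). *)
Definition enkf_stability (R : realType) (d q K : nat) (H : 'M[R]_(q, d))
    (Psi : {mfun 'cV[R]_d >-> 'cV[R]_d})
    (Q : nat -> R.-pker 'cV[R]_d ~> 'cV[R]_d) (nu : probability 'cV[R]_q R)
    (beta : R) (choice : cov_choice R d K) : Prop :=
  exists D M : R, [/\ 0 < D, 0 < M,
    forall d0 (Omega : measurableType d0) (P : probability Omega R)
      (X : enkf P H Psi Q nu choice), observable_stability X beta D M &
    q = d -> exists2 kappa : R, 0 < kappa &
      forall d0 (Omega : measurableType d0) (P : probability Omega R)
        (X : enkf P H Psi Q nu choice), full_stability X beta D M kappa].

(* Main.v *)
Require Import Defs.
From HB Require Import structures.
From mathcomp Require Import all_boot all_order all_algebra.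
From mathcomp Require Import all_classical all_reals all_analysis.
From mathcomp Require Import measurable_realfun.
From mathcomp Require Import ring lra.

Import Order.TTheory GRing.Theory Num.Theory.
Import numFieldNormedType.Exports.

Local Open Scope classical_set_scope.
Local Open Scope ring_scope.

Set Implicit Arguments.
Unset Strict Implicit.
Unset Printing Implicit Defensive.

(* With S = H C H^T and G = (I + S)^-1, the analysis step reads
   H V = G (H Vhat) + S G (H U + xi + xi_k).  Since C is positive semidefinite,
   |y|^2 + |S y|^2 <= |y + S y|^2, so G and S G are contractions whatever C is,
   and |H V|^2 <= (1 + b/2) |H Vhat|^2 + 3 (1 + 2/b) (|H U|^2 + |xi|^2 + |xi_k|^2)
   holds pointwise.  Integrating over an event of the past, each term involves a
   single noise, so no independence between the noises is used; the energy
   criterion bounds the two forecast terms, and a large weight M on |H U|^2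
   absorbs the coupling.  The conditional expectations exist by Radon-Nikodym. *)

(** The estimate for a member cannot close on its own: the perturbed observation contains [H U], so
    the signal feeds into every member. Young's inequality is therefore used asymmetrically. The
    forecast must keep a factor close to 1, and the weight b/2 is affordable since (1 + b/2)(1 - b)
    <= 1 - b/2, which is where half of the rate goes; the large factor left on the observation is
    harmless because the signal contracts by itself. The initial law is arbitrary, so energies may
    have infinite mean. The one-step bounds are therefore inequalities between integrals with values
    in [0, +oo] over events of the past, obtained by adding nonnegative terms; truncation occurs
    only when passing to conditional expectations. The energy of Psi(V) + zeta mixes a past variable
    with a fresh noise, whose law is given only on product events. Disintegration allows V to be
    frozen while the noise is integrated. *)

Section kernel_precomposition.
Context d d' d'' (X : measurableType d) (Y : measurableType d')
  (Z : measurableType d'') (R : realType).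
Variables (k : R.-pker Y ~> Z) (f : X -> Y).

(** Turns the law of a noise, indexed by the preceding state, into a kernel indexed by the sample
    point. The measurability proof is part of the term so that the kernel structure can be attached
    to it. *)
Definition kprecomp (_ : measurable_fun [set: X] f) (x : X) :
  {measure set Z -> \bar R} := k (f x).

Hypothesis mf : measurable_fun [set: X] f.

Let measurable_kprecomp U : measurable U ->
  measurable_fun [set: X] (kprecomp mf ^~ U).
Proof. by move=> mU; exact: measurableT_comp (measurable_kernel k U mU) mf. Qed.

HB.instance Definition _ := isKernel.Build _ _ _ _ _ (kprecomp mf)
  measurable_kprecomp.

Let kprecomp_prob x : kprecomp mf x [set: Z] = 1%E.
Proof. exact: prob_kernel. Qed.

HB.instance Definition _ := Kernel_isProbability.Build _ _ _ _ _
  (kprecomp mf) kprecomp_prob.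

End kernel_precomposition.

(** * Integration against a joint law described by a kernel *)

Section disintegration.
Context d d' (S : measurableType d) (T : measurableType d') (R : realType).
Local Open Scope ereal_scope.

(** The right-hand side is the integral against a composition of kernels, a measure that agrees with
    [joint] on rectangles and hence everywhere. *)
Lemma ge0_integral_disintegration (mu : probability S R) (k : R.-pker S ~> T)
    (joint : probability (S * T)%type R) (f : S * T -> \bar R) :
  (forall A B, measurable A -> measurable B ->
     joint (A `*` B) = \int[mu]_(s in A) k s B) ->
  (forall x, 0 <= f x) -> measurable_fun setT f ->
  \int[joint]_x f x = \int[mu]_s \int[k s]_t f (s, t).
Proof.
move=> jointE f0 mf.
have mmu : measurable_fun [set: unit] (fun=> mu : pprobability S R).
  exact: measurable_cst.
have mpair : measurable_fun [set: (unit * S) * T] (fun p => (p.1.2, p.2)).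
  by apply: measurable_fun_pair => //; exact: measurableT_comp.
have msnd : measurable_fun [set: unit * S] snd by exact: measurable_snd.
(* Composition of kernels forgets the intermediate point s; the Dirac kernel [k2] puts it back into
   the result. *)
pose l : R.-sfker unit ~> S := kprobability mmu.
pose k1 : R.-sfker (unit * S) ~> T := kprecomp k msnd.
pose k2 : R.-sfker ((unit * S) * T) ~> (S * T)%type := kdirac mpair.
pose k12 : R.-sfker (unit * S) ~> (S * T)%type := k1 \; k2.
have intE g : (forall x, 0 <= g x) -> measurable_fun setT g ->
    \int[kcomp l k12 tt]_x g x = \int[mu]_s \int[k s]_t g (s, t).
  move=> g0 mg; rewrite integral_kcomp//; apply: eq_integral => s _.
  rewrite integral_kcomp//; apply: eq_integral => t _.
  by rewrite integral_dirac// diracT mul1e.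
rewrite -intE//; apply: eq_measure_integral => D mD _.
(* Rectangles are stable under intersection, generate the product sigma-algebra and contain the
   whole space. *)
apply: (measure_unique [set A `*` B | A in measurable & B in measurable]
  (fun=> setT)) => //.
- exact: measurable_prod_measurableType.
- move=> _ _ [A1 mA1 [B1 mB1 <-]] [A2 mA2 [B2 mB2 <-]].
  exists (A1 `&` A2); first exact: measurableI.
  by exists (B1 `&` B2); [exact: measurableI|rewrite setXI].
- by move=> _; exists setT => //; exists setT => //; rewrite setXTT.
- by rewrite bigcup_const.
- move=> _ [A mA [B mB <-]]; transitivity (\int[mu]_(s in A) k s B);
    first exact: jointE.
  have mAB : measurable (A `*` B) by exact: measurableX.
  rewrite -[A `*` B]setIT -integral_indic// intE//; last first.
    exact/measurable_EFinP/measurable_indic.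
  rewrite integral_mkcond; apply: eq_integral => s _; rewrite patchE.

  case: ifPn => [|/negP] sA.
    rewrite -[B in LHS]setIT -integral_indic//; apply: eq_integral => t _.
    rewrite !indicE; congr (_%:R%:E); congr nat_of_bool; apply/idP/idP.
      by move=> /set_mem Bt; apply/mem_set; split => //; exact/set_mem.
    by move=> /set_mem[_ Bt]; apply/mem_set.
  rewrite integral0_eq// => t _; rewrite indicE memNset// => -[As _].
  by apply: sA; rewrite inE.
- by move=> _; rewrite (le_lt_trans (probability_le1 _ _))// ltry.
Qed.
End disintegration.

(** * Freezing a past variable under the conditional law of a noise *)

Section conditional_law.
Context d (Omega : measurableType d) (R : realType) (P : probability Omega R).
Context d1 d2 (S : measurableType d1) (T : measurableType d2).
Variable G : set (set Omega).
Hypothesis sG : sigma_algebra setT G.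
Hypothesis Gm : G `<=` measurable.
Local Open Scope ereal_scope.

Let OmegaG := g_sigma_algebraType G.

Lemma measurable_sub_sigma_id : measurable_fun setT (id : Omega -> OmegaG).
Proof.
move=> _ A mA; rewrite setTI; apply: Gm.
by rewrite /= -(measurable_g_measurableTypeE sG).
Qed.

(** Its distribution is the restriction of [P] to [G]. *)
Definition sub_sigma_id : {mfun Omega >-> OmegaG} :=
  HB.pack (id : Omega -> OmegaG)
    (isMeasurableFun.Build _ _ _ _ (id : Omega -> OmegaG)
       measurable_sub_sigma_id).

(** The joint law of the sample point, seen through [G], and of [z] disintegrates along the kernel
    [k (U w)]; since [U] is [G]-measurable, it is a function of the first coordinate. *)
Lemma ge0_integral_conditional_law (k : R.-pker S ~> T)
    (U : Omega -> S) (z : {mfun Omega >-> T}) (f : S * T -> \bar R) :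
  (forall B, measurable B -> G (U @^-1` B)) ->
  (forall A B, G A -> measurable B ->
     P (A `&` z @^-1` B) = \int[P]_(w in A) k (U w) B) ->
  (forall x, 0 <= f x) -> measurable_fun setT f ->
  forall A, G A ->
  \int[P]_(w in A) f (U w, z w) = \int[P]_(w in A) \int[k (U w)]_t f (U w, t).
Proof.
move=> GU Pz f0 mf A GA.
have mU : measurable_fun setT (U : OmegaG -> S).
  move=> _ B mB; rewrite setTI [X in X _](measurable_g_measurableTypeE sG).
  exact: GU.
have mA : measurable (A : set OmegaG).
  by rewrite [X in X _](measurable_g_measurableTypeE sG).
pose mu : probability OmegaG R := distribution P sub_sigma_id.
have mwz : measurable_fun setT (fun w => (sub_sigma_id w, z w)).
  by apply: measurable_fun_pair.
pose wz : {mfun Omega >-> (OmegaG * T)%type} :=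
  HB.pack (fun w => (sub_sigma_id w, z w)) (isMeasurableFun.Build _ _ _ _ _ mwz).
pose joint : probability (OmegaG * T)%type R := distribution P wz.
(* The event [A] is absorbed into the integrand, so that one identity on the whole product is
   enough. *)
pose F (x : OmegaG * T) := (f (U x.1, x.2) * (\1_A x.1)%:E).
have F0 x : 0 <= F x by rewrite /F mule_ge0// lee_fin.
have mF : measurable_fun setT F.
  apply: emeasurable_funM.
    apply: (measurableT_comp mf); apply: measurable_fun_pair => //.
    exact: measurableT_comp.
  apply/measurable_EFinP.
  exact: (measurableT_comp (measurable_indic mA) measurable_fst).
have jointE A' B : measurable A' -> measurable B ->
    joint (A' `*` B) = \int[mu]_(s in A') kprecomp k mU s B.
  move=> mA' mB; have GA' : G A' by rewrite -(measurable_g_measurableTypeE sG).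
  rewrite ge0_integral_pushforward//; last first.
    exact/measurable_funTS/measurable_kernel.
  rewrite -(Pz A')//; congr (P _).
have := ge0_integral_disintegration jointE F0 mF.
rewrite ge0_integral_distribution// ge0_integral_distribution//; last 2 first.
- exact: (measurable_fun_integral_finite_kernel F (kprecomp k mU)).
- by move=> s; exact: integral_ge0.
move=> intF; rewrite [LHS]integral_mkcond [RHS]integral_mkcond.
transitivity (\int[P]_w (F \o wz) w); last rewrite intF.
  apply: eq_integral => w _; rewrite patchE /F /= indicE.
  by case: ifPn => _; rewrite ?mule1 ?mule0.
apply: eq_integral => w _; rewrite patchE /F /= indicE.
case: ifPn => wA; last by rewrite integral0_eq// => t _; rewrite mule0.
by apply: eq_integral => t _; rewrite mule1.
Qed.

End conditional_law.

(** * Existence of conditional expectations and upper bounds for them *)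

Section conditional_expectation_bound.
Context d (Omega : measurableType d) (R : realType) (P : probability Omega R).
Variable G : set (set Omega).
Hypothesis sG : sigma_algebra setT G.
Hypothesis Gm : G `<=` measurable.
Local Open Scope ereal_scope.

Let OmegaG := g_sigma_algebraType G.
Let PG : probability OmegaG R := distribution P (sub_sigma_id sG Gm).

(** The integral of [Y] over events of [G] is a finite measure dominated by the restriction of [P];
    its density is measurable for [G] because everything takes place on [OmegaG]. *)
Let cond_density (Y : Omega -> \bar R) : P.-integrable setT Y ->
  (forall w, 0 <= Y w) ->
  exists f : OmegaG -> \bar R, [/\ forall w, 0 <= f w, measurable_fun setT f &
    forall A, G A -> \int[P]_(w in A) f w = \int[P]_(w in A) Y w].
Proof.
move=> intY Y0.
pose nu (A : set OmegaG) := \int[P]_(w in A) Y w.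
have mG (A : set OmegaG) : measurable A -> d.-measurable A.
  by rewrite [X in X _ -> _](measurable_g_measurableTypeE sG); exact: Gm.
have nu0 : nu set0 = 0 by rewrite /nu integral_set0.
have nu_ge0 A : 0 <= nu A by exact: integral_ge0.
have nu_sigma : semi_sigma_additive nu.
  move=> F mF tF mUF; apply: semi_sigma_additive_nng_induced => //.
  - exact: (measurable_int P).
  - by move=> n; exact: mG.
  - exact: mG.
pose nu_mixin := isMeasure.Build _ _ _ nu nu0 nu_ge0 nu_sigma.
pose mu : {measure set OmegaG -> \bar R} := HB.pack nu nu_mixin.
have finmu : fin_num_fun mu.
  move=> A /mG mA; apply: integrable_fin_num => //.
  exact: integrableS intY.
pose fmu : {finite_measure set OmegaG -> \bar R} :=
  HB.pack nu nu_mixin (Measure_isFinite.Build _ _ _ mu finmu).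
have dom : fmu `<< PG.
  apply/null_content_dominatesP => A /mG mA PA0.
  apply: null_set_integral => //.
  exact/measurable_funTS/(measurable_int P).
have [f [f0 _ intf fE]] := radon_nikodym_sigma_finite dom.
exists f; split => //; first exact: (measurable_int PG).
move=> A GA; have mA : measurable (A : set OmegaG).
  by rewrite [X in X _](measurable_g_measurableTypeE sG).
apply: (eq_trans _ (esym (fE A mA))).
rewrite ge0_integral_pushforward//.
by move: (measurable_int PG intf); exact: measurable_funTS.
Qed.

Lemma cond_expectation_exists (Y : Omega -> R) : measurable_fun setT Y ->
  (forall w, (0 <= Y w)%R) ->
  exists W, is_cond_expectation P G (EFin \o Y) W.
Proof.
move=> mY Y0.
(* Y is cut into bounded slices, each of which has a finite integral. *)
pose D n := Y @^-1` `[n%:R, n.+1%:R[%classic.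
have mD n : measurable (D n) by rewrite -[D n]setTI; exact: mY.
pose Yn n := (EFin \o Y) \_ (D n).
have Yn0 n w : 0 <= Yn n w by rewrite /Yn patchE; case: ifPn; rewrite ?lee_fin.
have mYn n : measurable_fun setT (Yn n).
  apply/(measurable_restrictT _ _).1 => //.
  exact/measurable_funTS/measurable_EFinP.
have intYn n : P.-integrable setT (Yn n).
  apply: (@le_integrable _ _ _ P setT measurableT _ (EFin \o cst n.+1%:R)) => //.
    move=> w _; rewrite gee0_abs// /Yn patchE.
    case: ifPn => [|_]; last exact: abse_ge0.
    rewrite inE /D/= in_itv/= => /andP[_ Yw].
    by rewrite lee_fin (le_trans (ltW Yw))// ler_norm.
  exact: finite_measure_integrable_cst.
have tD : trivIset setT D.
  apply/trivIsetP => i j _ _ /eqP ij; apply/seteqP; split => // w [].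
  rewrite /D/= !in_itv/= => /truncn_def ? /truncn_def ?; apply: ij; congruence.
have DT : \bigcup_n D n = setT.
  apply/seteqP; split => // w _; exists (Num.truncn (Y w)) => //.
  by rewrite /D/= in_itv/=; exact: truncn_itv.
have /choice[f fP] := fun n => cond_density (intYn n) (Yn0 n).
have f0 n w : 0 <= f n w by have [] := fP n.
have mf n : measurable_fun setT (f n : OmegaG -> \bar R) by have [] := fP n.
have mG (g : Omega -> \bar R) : measurable_fun setT (g : OmegaG -> \bar R) ->
    measurable_fun setT g.
  by move=> mg; exact: (measurableT_comp mg (measurable_sub_sigma_id sG Gm)).
(* Sums of nonnegative functions commute with the integral, so the densities of the slices add up
   even when [Y] has infinite mean. *)
exists (fun w => \sum_(n <oo) f n w); split.
- by move=> w; exact: nneseries_ge0.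
- move=> B mB; rewrite -(measurable_g_measurableTypeE sG).
  rewrite -[_ @^-1` _]setTI; apply: (ge0_emeasurable_sum (D := setT)) => //.
- move=> A GA; have mA := Gm GA.
  rewrite integral_nneseries//; last first.
    by move=> n; apply/measurable_funTS/mG.
  rewrite -[in RHS](setIT A) -DT setI_bigcupr ge0_integral_bigcup//.
  + apply: eq_eseriesr => n _; rewrite integral_mkcondr.
    by have [_ _ ->] := fP n.
  + by move=> n; exact: measurableI.
  + exact/measurable_funTS/measurable_EFinP.
  + by move=> w _; rewrite lee_fin.
  + exact: trivIset_setIl.
Qed.

(** The set where a version exceeds [b] lies in [G]. There the integral hypothesis forces the
    version to equal [b] almost everywhere, so the set is negligible. *)
Lemma cond_expectation_le (Y b : Omega -> R) : measurable_fun setT Y ->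
  (forall w, (0 <= Y w)%R) -> (forall w, (0 <= b w)%R) ->
  (forall B, measurable B -> G (b @^-1` B)) ->
  (forall A, G A -> \int[P]_(w in A) (Y w)%:E <= \int[P]_(w in A) (b w)%:E) ->
  {ae P, forall w, cond_expectation P G (EFin \o Y) w <= (b w)%:E}.
Proof.
move=> mY Y0 b0 Gb Yb; rewrite /cond_expectation.
(* Existence excludes the default [+oo] of [cond_expectation]. *)
have /cid [W0 W0P] := cond_expectation_exists mY Y0.
have /= := xgetPex (cst +oo%E) (ex_intro _ W0 W0P).
set W := xget _ _ => -[W0' GW WY].
have mGr (g : OmegaG -> \bar R) : (forall B, measurable B -> G (g @^-1` B)) ->
    measurable_fun setT g.
  move=> Gg _ B mB; rewrite setTI.
  by rewrite [X in X _](measurable_g_measurableTypeE sG); exact: Gg.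
have mW : measurable_fun setT (W : OmegaG -> \bar R) by exact: mGr.
have mb : measurable_fun setT (EFin \o b : OmegaG -> \bar R).
  apply/measurable_EFinP => _ B mB; rewrite setTI.
  by rewrite [X in X _](measurable_g_measurableTypeE sG); exact: Gb.
have mG (g : Omega -> \bar R) : measurable_fun setT (g : OmegaG -> \bar R) ->
    measurable_fun setT g.
  by move=> mg; exact: (measurableT_comp mg (measurable_sub_sigma_id sG Gm)).
(* Cutting at [b <= k] makes both integrals finite, so that they may be subtracted; the sets [N k]
   exhaust the exceptional set because [b] is real-valued. *)
pose N (k : nat) := [set w | (b w)%:E < W w] `&` [set w | (b w)%:E <= k%:R%:E].
have GN k : G (N k).
  rewrite -(measurable_g_measurableTypeE sG); apply: measurableI.
    by rewrite -[X in measurable X]setTI; exact: measurable_lte.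
  by rewrite -[X in measurable X]setTI; exact: measurable_lee.
suff N0 k : P.-negligible (N k).
  apply: negligibleS (negligible_bigcup N0) => w /=.
  move=> /negP; rewrite -ltNge => bW; exists (Num.truncn (b w)).+1 => //.
  split => //=; rewrite lee_fin ltW//; have /andP[] := truncn_itv (b0 w) => //.
have mN : measurable (N k) by exact: Gm.
have intb : P.-integrable (N k) (EFin \o b).
  apply: (@le_integrable _ _ _ P _ mN _ (EFin \o cst k%:R)).
  - exact/measurable_funTS/mG.
  - by move=> w [_ /=]; rewrite !lee_fin !ger0_norm.
  - exact: finite_measure_integrable_cst.
have leWb : \int[P]_(w in N k) W w <= \int[P]_(w in N k) (b w)%:E.
  by rewrite WY//; exact: Yb.
have intW : P.-integrable (N k) W.
  apply/integrableP; split; first exact/measurable_funTS/mG.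
  under eq_integral do rewrite gee0_abs//.
  rewrite (le_lt_trans leWb)//.
  by have /integrableP[_] := intb; under eq_integral do rewrite gee0_abs ?lee_fin//.
have : \int[P]_(w in N k) `|(W \- (EFin \o b)) w| = 0.
  under eq_integral => w wN.
    rewrite gee0_abs; last first.
      by rewrite sube_ge0 ?lee_fin//; move: wN; rewrite inE => -[/ltW].
    over.
  have finb : \int[P]_(w in N k) (EFin \o b) w \is a fin_num.
    exact: integrable_fin_num.
  rewrite integralB//; apply/eqP; rewrite eq_le sube_le0 ?finb// leWb/=.
  rewrite sube_ge0 ?finb//; apply: ge0_le_integral => //.
  - by move=> w _; rewrite lee_fin.
  - exact/measurable_funTS/mG.
  - exact/measurable_funTS/mG.
  - by move=> w [/ltW].
move/ae_eq_integral_abs => /(_ mN) [|E [mE E0 NE]].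
  by apply: emeasurable_funB; exact/measurable_funTS/mG.
exists E; split => // w Nw; apply: NE => /= /(_ Nw) WbE.
case: Nw => /=; rewrite -sube_gt0.
by have -> : W w - (b w)%:E = 0 by []; rewrite ltxx.
Qed.

End conditional_expectation_bound.

(** * Inequalities for the squared Euclidean norm *)

Section squared_norm.
Context (R : realType).

Lemma sqnorm_ge0 n (x : 'cV[R]_n) : 0 <= sqnorm x.
Proof. by apply: sumr_ge0 => i _; exact: sqr_ge0. Qed.

Lemma sqnormE n (x : 'cV[R]_n) : sqnorm x = (x^T *m x) 0 0.
Proof. by rewrite mxE; apply: eq_bigr => i _; rewrite mxE expr2. Qed.

Lemma sqnormD_le n (e : R) (x y : 'cV[R]_n) : 0 < e ->
  sqnorm (x + y) <= (1 + e) * sqnorm x + (1 + e^-1) * sqnorm y.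
Proof.
move=> e0; rewrite !mulr_sumr -big_split; apply: ler_sum => i _ /=.
rewrite mxE; set a := x i 0; set b := y i 0.
rewrite -subr_ge0 [leRHS](_ : _ = e * (a - e^-1 * b) ^+ 2); last first.
  by field; rewrite gt_eqF.
by rewrite mulr_ge0 ?sqr_ge0// ltW.
Qed.

Lemma sqnormD3_le n (x y z : 'cV[R]_n) :
  sqnorm (x + y + z) <= 3 * (sqnorm x + sqnorm y + sqnorm z).
Proof.
rewrite -!big_split mulr_sumr; apply: ler_sum => i _ /=; rewrite !mxE.
set a := x i 0; set b := y i 0; set c := z i 0.
have := addr_ge0 (addr_ge0 (sqr_ge0 (a - b)) (sqr_ge0 (b - c))) (sqr_ge0 (a - c)).
by rewrite !expr2; nra.
Qed.

(** Cauchy-Schwarz against the constant vector: after symmetrizing the double sum, it is 2xy <= x^2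
    + y^2 term by term. *)
Lemma sqr_sum_le n (a : 'I_n -> R) :
  (\sum_i a i) ^+ 2 <= n%:R * \sum_i a i ^+ 2.
Proof.
have -> : n%:R * \sum_i a i ^+ 2 =
    \sum_(i < n) \sum_(j < n) (a i ^+ 2 + a j ^+ 2) / 2.
  transitivity (\sum_(i < n) (n%:R * a i ^+ 2 + \sum_(j < n) a j ^+ 2) / 2).
    rewrite -mulr_suml big_split/= -mulr_sumr sumr_const card_ord.
    by rewrite -[_ *+ n]mulr_natl; field.
  apply: eq_bigr => i _; rewrite -mulr_suml big_split/= sumr_const card_ord.
  by rewrite mulr_natl.
rewrite expr2 mulr_suml; apply: ler_sum => i _.
rewrite mulr_sumr; apply: ler_sum => j _.
by have := sqr_ge0 (a i - a j); rewrite !expr2; nra.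
Qed.

(** A crude operator bound, obtained from [sqr_sum_le] and from bounding each coordinate by the
    whole norm. It serves to compare |Hu| with |u|, where some finite constant suffices. *)
Lemma sqnorm_mulmx_le m n (A : 'M[R]_(m, n)) (x : 'cV[R]_n) :
  sqnorm (A *m x) <= (n%:R * \sum_i \sum_j A i j ^+ 2) * sqnorm x.
Proof.
rewrite /sqnorm mulrAC -mulrA mulr_sumr.
rewrite mulr_sumr; apply: ler_sum => i _; rewrite mxE.
apply: (le_trans (sqr_sum_le _)); rewrite ler_wpM2l// mulrC mulr_suml.
apply: ler_sum => j _; rewrite exprMn ler_wpM2l ?sqr_ge0//.
rewrite (bigD1 j)//= lerDl; apply: sumr_ge0 => k _; exact: sqr_ge0.
Qed.

Lemma sqnorm_le_mulmx d (H : 'M[R]_d) : \rank H = d ->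
  exists2 c : R, 0 < c & forall u : 'cV[R]_d, sqnorm u <= c * sqnorm (H *m u).
Proof.
move=> rH; have uH : H \in unitmx by rewrite -row_full_unit /row_full rH.
have c0 : 0 <= d%:R * \sum_i \sum_j (invmx H) i j ^+ 2 :> R.
  rewrite mulr_ge0//; apply: sumr_ge0 => i _; apply: sumr_ge0 => j _.
  exact: sqr_ge0.
(* The bound for u = H^-1 (H u); the summand 1 gives strict positivity at once. *)
exists (1 + d%:R * \sum_i \sum_j (invmx H) i j ^+ 2) => [|u].
  by rewrite ltr_wpDr.
rewrite -{1}[u](mulKmx uH) (le_trans (sqnorm_mulmx_le _ _))//.
by rewrite ler_wpM2r ?sqnorm_ge0// lerDr.
Qed.

End squared_norm.

(** * Positive semidefinite matrices and the analysis step *)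

Section positive_semidefinite.
Context (R : realType).

Lemma psdmx_add n (A B : 'M[R]_n) : psdmx A -> psdmx B -> psdmx (A + B).
Proof.
move=> [AT A0] [BT B0]; split; first by rewrite linearD/= AT BT.
by move=> x; rewrite mulmxDr mulmxDl mxE addr_ge0.
Qed.

Lemma psdmx_scale n (a : R) (A : 'M[R]_n) : 0 <= a -> psdmx A -> psdmx (a *: A).
Proof.
move=> a0 [AT A0]; split; first by rewrite linearZ/= AT.
by move=> x; rewrite -scalemxAr -scalemxAl mxE mulr_ge0.
Qed.

Lemma psdmx_scalar n (a : R) : 0 <= a -> psdmx (a%:M : 'M[R]_n).
Proof.
move=> a0; split; first exact: tr_scalar_mx.
by move=> x; rewrite mul_mx_scalar -scalemxAl mxE -sqnormE mulr_ge0 ?sqnorm_ge0.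
Qed.

Lemma psdmx_outer n (v : 'cV[R]_n) : psdmx (v *m v^T).
Proof.
split; first by rewrite trmx_mul trmxK.
move=> x; rewrite mulmxA -mulmxA.
have -> : x^T *m v = (v^T *m x)^T by rewrite trmx_mul trmxK.
by rewrite -sqnormE sqnorm_ge0.
Qed.

Lemma psdmx_sum n (I : finType) (A : I -> 'M[R]_n) :
  (forall i, psdmx (A i)) -> psdmx (\sum_i A i).
Proof.
move=> A0; elim/big_ind : _ => //; last exact: psdmx_add.
by split=> [|x]; rewrite ?trmx0// mulmx0 mul0mx mxE.
Qed.

Lemma psdmx_sample_cov d K (W : 'M[R]_(d, K)) : psdmx (sample_cov W).
Proof.
apply: psdmx_scale; first by rewrite invr_ge0.
by apply: psdmx_sum => k; exact: psdmx_outer.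
Qed.

Lemma psdmx_congr m n (H : 'M[R]_(m, n)) (C : 'M[R]_n) :
  psdmx C -> psdmx (H *m C *m H^T).
Proof.
move=> [CT C0]; split; first by rewrite !trmx_mul trmxK CT mulmxA.
by move=> x; have := C0 (H^T *m x); rewrite trmx_mul trmxK !mulmxA.
Qed.

(** Expanding the square, the two cross terms coincide by symmetry and equal the quadratic form of
    [S] at [y]. *)
Lemma psdmx_resolvent n (S : 'M[R]_n) (y : 'cV[R]_n) : psdmx S ->
  sqnorm y + sqnorm (S *m y) <= sqnorm (y + S *m y).
Proof.
move=> [ST S0].
rewrite !sqnormE [(y + _)^T]raddfD/= mulmxDl !mulmxDr.
have DE (A B : 'M[R]_1) : (A + B) 0 0 = A 0 0 + B 0 0 by rewrite mxE.
rewrite !DE.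
have := S0 y; rewrite -mulmxA.
have -> : (S *m y)^T *m y = y^T *m (S *m y).
  by rewrite trmx_mul ST mulmxA.
lra.
Qed.

(** A row x of the kernel satisfies x^T + S x^T = 0, and [psdmx_resolvent] then gives |x|^2 <= 0. *)
Lemma psdmx_unit n (S : 'M[R]_n) : psdmx S -> 1%:M + S \in unitmx.
Proof.
move=> pS; rewrite -row_free_unit -kermx_eq0; apply/eqP/row_matrixP => i.
set x := row i _; have : x *m (1%:M + S) = 0.
  by rewrite -row_mul mulmx_ker row0.
rewrite mulmxDr mulmx1 => /(congr1 trmx).
rewrite linearD/= trmx_mul pS.1 trmx0 => y0.
have := psdmx_resolvent x^T pS; rewrite y0.
have -> : sqnorm (0 : 'cV[R]_n) = 0.
  by rewrite /sqnorm big1// => j _; rewrite mxE expr0n.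
have := sqnorm_ge0 (S *m x^T) => s1 s2.
have : sqnorm x^T = 0 by apply/eqP; rewrite eq_le sqnorm_ge0 andbT; lra.
move=> /eqP; rewrite psumr_eq0 => [/allP x0|j _]; last exact: sqr_ge0.
apply/rowP => j; have := x0 j (mem_index_enum _).
by rewrite sqrf_eq0 !mxE => /eqP ->.
Qed.

Lemma analysis_sqnorm_le d q (H : 'M[R]_(q, d)) (C : 'M[R]_d)
    (v : 'cV[R]_d) (z : 'cV[R]_q) (e : R) : 0 < e -> psdmx C ->
  sqnorm (H *m (v - kalman_gain H C *m (H *m v - z)))
  <= (1 + e) * sqnorm (H *m v) + (1 + e^-1) * sqnorm z.
Proof.
move=> e0 /(psdmx_congr H) pS; set S := H *m C *m H^T in pS.
have uS := psdmx_unit pS; set G := invmx (1%:M + S).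
(* The identity G + S G = 1 gives both the decomposition of the update, through 1 - S G = G, and the
   two contractions, through [psdmx_resolvent] at y = G a. *)
have GS (a : 'cV[R]_q) : G *m a + S *m (G *m a) = a.
  by rewrite -{1}[G *m a]mul1mx -mulmxDl mulKVmx.
have -> : H *m (v - kalman_gain H C *m (H *m v - z))
    = G *m (H *m v) + S *m (G *m z).
  have HK w : H *m (kalman_gain H C *m w) = S *m (G *m w).
    by rewrite /kalman_gain !mulmxA.
  rewrite mulmxBr HK [G *m (_ - _)]mulmxBr [S *m (_ - _)]mulmxBr.
  rewrite opprB addrA addrAC; congr (_ + _).
  by apply/eqP; rewrite subr_eq; apply/eqP; rewrite GS.
have GSle a : sqnorm (G *m a) + sqnorm (S *m (G *m a)) <= sqnorm a.
  by have := psdmx_resolvent (G *m a) pS; rewrite GS.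
apply: (le_trans (sqnormD_le _ _ e0)); apply: lerD.
  apply: ler_wpM2l; first by rewrite addr_ge0// ltW.
  by apply: (le_trans _ (GSle _)); rewrite lerDl sqnorm_ge0.
apply: ler_wpM2l; first by rewrite addr_ge0// invr_ge0 ltW.
by apply: (le_trans _ (GSle _)); rewrite lerDr sqnorm_ge0.
Qed.

End positive_semidefinite.

(** * Compactness of sublevel sets *)

Section compactness.
Context (R : realType).

Lemma vec_mx_continuous m n : continuous (@vec_mx R m n).
Proof.
move=> v s /= /(nbhs_ballP (vec_mx v)) [e e0 es].
apply/nbhs_ballP; exists e => //= w [_ vw]; apply: es; split => // i j.
by rewrite !mxE; exact: vw.
Qed.

(** Flattening a matrix into a row vector turns the box into a product of segments. *)
Lemma mx_box_compact m n (r : R) :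
  compact [set A : 'M[R]_(m, n) | forall i j, `|A i j| <= r].
Proof.
have rvc := @rV_compact R (m * n) (fun=> `[- r, r]%classic)
  (fun=> @segment_compact R (- r) r).
rewrite (_ : mkset _ = @vec_mx R m n @`
    [set v : 'rV[R]_(m * n) | forall i, `[- r, r]%classic (v ord0 i)]).
  apply: continuous_compact rvc.
  exact/continuous_subspaceT/vec_mx_continuous.
apply/seteqP; split=> [A Ar|_ [v vr <-] i j].
  exists (mxvec A); last exact: mxvecK.
  move=> i; case/mxvec_indexP: i => i j.
  by rewrite /= in_itv/= mxvecE -ler_norml.
by rewrite mxE ler_norml; have := vr (mxvec_index i j); rewrite /= in_itv.
Qed.

Lemma sqnorm_mulmx_colE q d K (H : 'M[R]_(q, d)) (A : 'M[R]_(d, K)) k :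
  sqnorm (H *m col k A) = \sum_i (\sum_j H i j * A j k) ^+ 2.
Proof.
apply: eq_bigr => i _; rewrite mxE; congr (_ ^+ 2).
by apply: eq_bigr => j _; rewrite mxE.
Qed.

Lemma sqnorm_mulmx_col_continuous (X : topologicalType) q d K (H : 'M[R]_(q, d))
    (f : X -> 'M[R]_(d, K)) (k : 'I_K) : continuous f ->
  continuous (fun x => sqnorm (H *m col k (f x))).
Proof.
move=> cf; under eq_fun do rewrite sqnorm_mulmx_colE.
apply: continuous_big => [|i _]; first exact: add_continuous.
move=> x; apply: (@continuous_comp _ _ _ _ (fun y : R => y ^+ 2)); last first.
  exact: exprn_continuous.
move: x; apply: continuous_big => [|j _]; first exact: add_continuous.
move=> x; apply: cvgMr.
apply: (@continuous_comp _ _ _ f (fun A : 'M[R]_(d, K) => A j k)).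
  exact: cf.
exact: coord_continuous.
Qed.

Lemma energy_continuous q d K (H : 'M[R]_(q, d)) (M : R) :
  continuous (@energy R d q K H M).
Proof.
(* The signal is viewed as its own single column, so that one continuity lemma serves both parts of
   the state. *)
have -> : @energy R d q K H M = fun x =>
    \sum_(k < K) sqnorm (H *m col k x.2)
    + K%:R * M * sqnorm (H *m col 0 x.1).
  by apply/funext => x; rewrite /energy col_id.
move=> x; apply: cvgD.
  move: x; apply: continuous_big => [|k _]; first exact: add_continuous.
  by apply: sqnorm_mulmx_col_continuous => x; exact: cvg_snd.
apply: cvgMr; apply: (@sqnorm_mulmx_col_continuous _ _ _ _ H fst) => y.
exact: cvg_fst.
Qed.

Lemma entry_sqnorm_le n (x : 'cV[R]_n) i : x i 0 ^+ 2 <= sqnorm x.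
Proof.
by rewrite /sqnorm (bigD1 i)//= lerDl; apply: sumr_ge0 => j _; exact: sqr_ge0.
Qed.

Lemma total_square_le_compact d K (E : 'cV[R]_d * 'M[R]_(d, K) -> R)
    (kappa : R) : continuous E ->
  (forall x, total_square x <= kappa * E x) -> 0 <= kappa ->
  forall a, compact [set x | E x <= a].
Proof.
move=> cE kE k0 a; set r := kappa * a + 1.
(* From (|y| - 1)^2 >= 0 one gets |y| <= y^2 + 1, so the radius [kappa * a + 1] does the work of a
   square root. *)
have sqr_le (y : R) : y ^+ 2 <= kappa * a -> `|y| <= r.
  rewrite -real_normK ?num_real// /r => ya.
  by have := sqr_ge0 (`|y| - 1); rewrite sqrrB1; nra.
apply: (@subclosed_compact _ _
   ([set u : 'cV[R]_d | forall i j, `|u i j| <= r]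
    `*` [set A : 'M[R]_(d, K) | forall i j, `|A i j| <= r])).
- exact: ((continuous_closedP E).1 cE _ (@closed_le R a)).
- by apply: compact_setX; exact: mx_box_compact.
- move=> [u V]/= Ea; have := le_trans (kE (u, V)) (ler_wpM2l k0 Ea).
  rewrite /total_square/= => tle.
  have V0 k : 0 <= sqnorm (col k V) by exact: sqnorm_ge0.
  split => [i j|i k]; apply: sqr_le; apply: (le_trans _ tle).
    rewrite ord1 (le_trans (entry_sqnorm_le u i))// lerDl.
    exact: sumr_ge0.
  rewrite (bigD1 k)//= addrCA.
  have := entry_sqnorm_le (col k V) i; rewrite mxE => /le_trans; apply.
  by rewrite lerDl addr_ge0 ?sqnorm_ge0// sumr_ge0.
Qed.

End compactness.

(** * Measurability of matrix-valued maps and of the energies *)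

Section measurable_matrix_functions.
Context (R : realType).

Lemma measurable_mx_entry d (T : measurableType d) m n i j :
  measurable_fun [set: 'M[T]_(m, n)] (fun A => A i j).
Proof.
move=> _ B mB; rewrite setTI; apply: sub_sigma_algebra.
by exists (i, j) => //; exists B => //; rewrite setTI.
Qed.

Lemma measurable_fun_mx d d' (X : measurableType d) (T : measurableType d')
    m n (f : X -> 'M[T]_(m, n)) :
  (forall i j, measurable_fun setT (fun x => f x i j)) -> measurable_fun setT f.
Proof.
move=> mf; apply: (measurability (\bigcup_(ij in [set: 'I_m * 'I_n])
  g_sigma_algebra_preimage (fun A : 'M[T]_(m, n) => A ij.1 ij.2))) => //.
move=> _ [_ [[i j] _ [B mB <-]] <-]; rewrite !setTI -comp_preimage.
by rewrite -[X in measurable X]setTI; exact: mf.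
Qed.

Lemma measurable_col d (T : measurableType d) m n (k : 'I_n) :
  measurable_fun setT (fun A : 'M[T]_(m, n) => col k A).
Proof.
apply: measurable_fun_mx => i j.
rewrite (_ : (fun _ => _) = fun A : 'M[T]_(m, n) => A i k).
  exact: measurable_mx_entry.
by apply/funext => A; rewrite mxE.
Qed.

Lemma measurable_sqnorm_mulmx d (X : measurableType d) q p (H : 'M[R]_(q, p))
    (f : X -> 'cV[R]_p) :
  measurable_fun setT f -> measurable_fun setT (fun x => sqnorm (H *m f x)).
Proof.
move=> mf; apply: measurable_sum => i; apply: measurable_funX.
rewrite (_ : (fun _ => _) = fun x => \sum_j H i j * f x j 0); last first.
  by apply/funext => x; rewrite mxE.
apply: measurable_sum => j; apply: measurable_funM => //.
exact: (measurableT_comp (measurable_mx_entry _ _) mf).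
Qed.

Lemma measurable_cVD d (X : measurableType d) p (f g : X -> 'cV[R]_p) :
  measurable_fun setT f -> measurable_fun setT g ->
  measurable_fun setT (fun x => f x + g x).
Proof.
move=> mf mg; apply: measurable_fun_mx => i j.
rewrite (_ : (fun _ => _) = fun x => f x i j + g x i j); last first.
  by apply/funext => x; rewrite mxE.
by apply: measurable_funD; exact: (measurableT_comp (measurable_mx_entry _ _)).
Qed.

Lemma measurable_energy q d K (H : 'M[R]_(q, d)) (M : R) :
  measurable_fun setT (@energy R d q K H M).
Proof.
apply: measurable_funD.
  apply: measurable_sum => k; apply: measurable_sqnorm_mulmx.
  exact: (measurableT_comp (measurable_col _) measurable_snd).
by apply: measurable_funM => //; exact: measurable_sqnorm_mulmx.
Qed.

Lemma measurable_total_square d K :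
  measurable_fun setT (@total_square R d K).
Proof.
have -> : @total_square R d K =
    fun x => sqnorm (1%:M *m x.1) + \sum_(k < K) sqnorm (1%:M *m col k x.2).
  apply/funext => x; rewrite /total_square mul1mx; congr (_ + _).
  by apply: eq_bigr => k _; rewrite mul1mx.
apply: measurable_funD; first exact: measurable_sqnorm_mulmx.
apply: measurable_sum => k; apply: measurable_sqnorm_mulmx.
exact: (measurableT_comp (measurable_col _) measurable_snd).
Qed.

End measurable_matrix_functions.

(** * Second moments of affine images of a noise *)

Section second_moments.
Context d (T : measurableType d) (R : realType) (mu : {measure set T -> \bar R}).

(** Integrability and the value are kept together, so that finite linear combinations carry both
    along. *)
Definition has_integral (f : T -> R) (m : R) :=
  mu.-integrable setT (EFin \o f) /\ (\int[mu]_x (f x)%:E = m%:E)%E.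

Lemma has_integral_cst c : mu setT = 1%E -> has_integral (cst c) c.
Proof.
move=> mu1; split; last first.
  by apply: (eq_trans (integral_cst mu measurableT c%:E)); rewrite mu1 mule1.
apply/integrableP; split; first exact/measurable_EFinP.
by rewrite [X in (X < _)%E](integral_cst mu measurableT `|c|%:E) mu1 mule1 ltry.
Qed.

Lemma has_integralD f g m p : has_integral f m -> has_integral g p ->
  has_integral (fun x => f x + g x) (m + p).
Proof.
move=> [intf fE] [intg gE]; split; first exact: (integrableD measurableT intf intg).
by rewrite EFinD -fE -gE -(integralD measurableT intf intg).
Qed.

Lemma has_integralZ c f m : has_integral f m ->
  has_integral (fun x => c * f x) (c * m).
Proof.
move=> [intf fE]; split; first exact: (integrableZl measurableT c intf).
by rewrite EFinM -fE -(integralZl measurableT intf c).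
Qed.

Lemma has_integral_sum (I : Type) (s : seq I) (f : I -> T -> R) (m : I -> R) :
  mu setT = 1%E -> (forall i, has_integral (f i) (m i)) ->
  has_integral (fun x => \sum_(i <- s) f i x) (\sum_(i <- s) m i).
Proof.
move=> mu1 fm; elim: s => [|i s ih].
  under eq_fun do rewrite big_nil.
  by rewrite big_nil; exact: has_integral_cst.
under eq_fun do rewrite big_cons.
by rewrite big_cons; exact: has_integralD.
Qed.

End second_moments.

Section affine_second_moment.
Context (R : realType).

(** In coordinates the integrand is a constant, plus a linear form with mean zero, plus a quadratic
    form whose mean is read off the covariance. *)
Lemma has_mean_cov_sqnorm d q (mu : {measure set 'cV[R]_d -> \bar R}) (S : 'M[R]_d)
    (H : 'M[R]_(q, d)) (a : 'cV[R]_d) : mu setT = 1%E -> has_mean_cov mu 0 S ->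
  (\int[mu]_z (sqnorm (H *m (a + z)))%:E
   = (sqnorm (H *m a) + \tr (H *m S *m H^T))%:E)%E.
Proof.
move=> mu1 [int2 mean cov].
have mE i : measurable_fun setT (fun z : 'cV[R]_d => z i 0).
  exact: measurable_mx_entry.
(* Products are dominated by sums of squares; below, first powers are dominated by 1 + z_i^2, which
   is integrable since the total mass is 1. *)
have prod_int i j : has_integral mu (fun z => z i 0 * z j 0) (S i j).
  split; last first.
    rewrite -cov; apply: eq_integral => z _.
    by rewrite !mxE !subr0.
  apply: (@le_integrable _ _ _ mu _ measurableT _
      (EFin \o (fun z => z i 0 ^+ 2 + z j 0 ^+ 2))).
  - by apply/measurable_EFinP/measurable_funM.
  - move=> z _; rewrite /= lee_fin [leRHS]ger0_norm ?addr_ge0 ?sqr_ge0//.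
    rewrite ler_norml; have := sqr_ge0 (z i 0 + z j 0).
    have := sqr_ge0 (z i 0 - z j 0); rewrite !expr2 => ? ?.
    by apply/andP; split; nra.
  - exact: (integrableD measurableT (int2 i) (int2 j)).
have lin_int i : has_integral mu (fun z => z i 0) 0.
  split; last by rewrite mean mxE.
  apply: (@le_integrable _ _ _ mu _ measurableT _
      (EFin \o (fun z => 1 + z i 0 ^+ 2))).
  - exact/measurable_EFinP.
  - move=> z _; rewrite /= lee_fin [leRHS]ger0_norm ?addr_ge0 ?sqr_ge0//.
    rewrite ler_norml; have := sqr_ge0 (z i 0 + 1).
    have := sqr_ge0 (z i 0 - 1); rewrite !expr2 => ? ?.
    by apply/andP; split; nra.
  - exact: (integrableD measurableT (has_integral_cst 1 mu1).1 (int2 i)).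
have sqnormDE z : sqnorm (H *m (a + z)) = \sum_i (((H *m a) i 0) ^+ 2
    + (\sum_j (2 * (H *m a) i 0 * H i j) * z j 0
       + \sum_j \sum_k (H i j * H i k) * (z j 0 * z k 0))).
  apply: eq_bigr => i _; rewrite mulmxDr mxE sqrrD -addrA; congr (_ + (_ + _)).
    rewrite [(H *m z) i 0]mxE mulr_sumr -mulr_natl mulr_sumr.
    by apply: eq_bigr => j _; ring.
  rewrite [(H *m z) i 0]mxE expr2 mulr_suml; apply: eq_bigr => j _.
  by rewrite mulr_sumr; apply: eq_bigr => k _; ring.
have : has_integral mu (fun z => sqnorm (H *m (a + z))) (\sum_i (((H *m a) i 0) ^+ 2
    + (\sum_j (2 * (H *m a) i 0 * H i j) * 0
       + \sum_j \sum_k (H i j * H i k) * S j k))).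
  under eq_fun do rewrite sqnormDE.
  apply: has_integral_sum => // i; apply: has_integralD.
    exact: has_integral_cst.
  apply: has_integralD.
    by apply: has_integral_sum => // j; exact: has_integralZ.
  apply: has_integral_sum => // j; apply: has_integral_sum => // k.
  exact: has_integralZ.
case=> _ ->; rewrite big_split/=; congr ((_ + _)%:E).
apply: eq_bigr => i _; rewrite big1 ?add0r => [|j _]; last by rewrite mulr0.
rewrite mxE exchange_big/=; apply: eq_bigr => k _.
rewrite !mxE mulr_suml; apply: eq_bigr => j _.
by ring.
Qed.

Lemma has_mean_cov1_sqnorm q (mu : probability 'cV[R]_q R) :
  has_mean_cov mu 0 1%:M -> (\int[mu]_z (sqnorm z)%:E = q%:R%:E)%E.
Proof.
move=> /(has_mean_cov_sqnorm 1%:M 0 (probability_setT mu)).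
rewrite mulmx0 trmx1 !mulmx1 mxtrace1.
have -> : sqnorm (0 : 'cV[R]_q) = 0.
  by rewrite /sqnorm big1// => j _; rewrite mxE expr0n.
by rewrite add0r => <-; apply: eq_integral => z _; rewrite add0r mul1mx.
Qed.

End affine_second_moment.

(** * Comparison of integrals with values in [0, +oo] *)

Section integral_comparison.
Context d (T : measurableType d) (R : realType) (mu : {measure set T -> \bar R}).
Local Open Scope ereal_scope.

(** Enough for monotonicity and additivity in [0, +oo], so no finiteness of moments has to be
    tracked. *)
Definition nonneg_measurable (f : T -> R) :=
  measurable_fun setT f /\ forall x, (0 <= f x)%R.

Lemma nonneg_measurableD f g : nonneg_measurable f -> nonneg_measurable g ->
  nonneg_measurable (fun x => f x + g x)%R.
Proof.
move=> [mf f0] [mg g0]; split; first exact: measurable_funD.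
by move=> x; rewrite addr_ge0.
Qed.

Lemma nonneg_measurableZ c f : (0 <= c)%R -> nonneg_measurable f ->
  nonneg_measurable (fun x => c * f x)%R.
Proof.
move=> c0 [mf f0]; split; first exact: measurable_funM.
by move=> x; rewrite mulr_ge0.
Qed.

Lemma nonneg_measurable_cst c : (0 <= c)%R -> nonneg_measurable (cst c).
Proof. by []. Qed.

Lemma le_integral_EFin A f g : measurable A -> nonneg_measurable f ->
  nonneg_measurable g -> (forall x, f x <= g x)%R ->
  \int[mu]_(x in A) (f x)%:E <= \int[mu]_(x in A) (g x)%:E.
Proof.
move=> mA [mf f0] [mg g0] fg; apply: ge0_le_integral => //.
- by move=> x _; rewrite lee_fin.
- exact/measurable_funTS/measurable_EFinP.
- exact/measurable_funTS/measurable_EFinP.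
- by move=> x _; rewrite lee_fin.
Qed.

Lemma integral_lincomb A (a b : R) f g : measurable A -> (0 <= a)%R ->
  (0 <= b)%R -> nonneg_measurable f -> nonneg_measurable g ->
  \int[mu]_(x in A) (a * f x + b * g x)%:E
  = a%:E * \int[mu]_(x in A) (f x)%:E + b%:E * \int[mu]_(x in A) (g x)%:E.
Proof.
move=> mA a0 b0 fP gP; under eq_integral do rewrite EFinD.
have [[maf af0] [mbg bg0]] := (nonneg_measurableZ a0 fP, nonneg_measurableZ b0 gP).
rewrite ge0_integralD//.
- under eq_integral do rewrite EFinM.
  rewrite ge0_integralZl//; last 2 first.
  + exact/measurable_funTS/measurable_EFinP/fP.1.
  + by move=> x _; rewrite lee_fin; exact: fP.2.
  under [X in _ + X]eq_integral do rewrite EFinM.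
  rewrite ge0_integralZl//.
  + exact/measurable_funTS/measurable_EFinP/gP.1.
  + by move=> x _; rewrite lee_fin; exact: gP.2.
- by move=> x _; rewrite lee_fin.
- exact/measurable_funTS/measurable_EFinP.
- by move=> x _; rewrite lee_fin.
- exact/measurable_funTS/measurable_EFinP.
Qed.

Lemma le_integral_lincomb A (a b : R) f g f' g' : measurable A ->
  (0 <= a)%R -> (0 <= b)%R -> nonneg_measurable f -> nonneg_measurable g ->
  nonneg_measurable f' -> nonneg_measurable g' ->
  \int[mu]_(x in A) (f x)%:E <= \int[mu]_(x in A) (f' x)%:E ->
  \int[mu]_(x in A) (g x)%:E <= \int[mu]_(x in A) (g' x)%:E ->
  \int[mu]_(x in A) (a * f x + b * g x)%:E
  <= \int[mu]_(x in A) (a * f' x + b * g' x)%:E.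
Proof.
move=> mA a0 b0 fP gP f'P g'P ff gg; rewrite !integral_lincomb//.
by apply: leeD; apply: lee_wpmul2l; rewrite ?lee_fin.
Qed.

End integral_comparison.

(** * The one-step estimates for signal, forecast and observational noise *)

Section enkf_one_step.
Context d0 (Omega : measurableType d0) (R : realType) (P : probability Omega R).
Context (d q K : nat) (H : 'M[R]_(q, d)) (Psi : {mfun 'cV[R]_d >-> 'cV[R]_d}).
Context (Q : nat -> R.-pker 'cV[R]_d ~> 'cV[R]_d) (nu : probability 'cV[R]_q R).
Context (choice : cov_choice R d K) (X : enkf P H Psi Q nu choice).
Variables (Rcov : 'cV[R]_d -> 'M[R]_d) (beta k : R).
Hypothesis Q_mean_cov : forall n u, has_mean_cov (Q n u) 0 (Rcov u).
Hypothesis nu_mean_cov : has_mean_cov nu 0 1%:M.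
Hypotheses (beta_gt0 : 0 < beta) (beta_lt1 : beta < 1) (k_gt0 : 0 < k).
Hypothesis OEC : observable_energy_criterion H Psi Rcov beta k.

Let history n := past (fun m w => (signal X m w, ensemble X m w))
  (fun m w => (zeta X m w, xi X m w, ens_zeta X m w, ens_xi X m w)) n.

Let mchain n : measurable_fun setT (chain X n).
Proof. exact: measurable_fun_pair. Qed.

Lemma natural_filtration_measurable n :
  natural_filtration (chain X) n `<=` measurable.
Proof.
apply: smallest_sub; first exact: sigma_algebra_measurable.
by move=> A [m _ [B mB <-]]; exact: mchain.
Qed.

Let history_measurable n : history n `<=` measurable.
Proof.
apply: smallest_sub; first exact: sigma_algebra_measurable.
move=> A [|[m _ [B mB <-]]]; first exact: natural_filtration_measurable.
suff : measurable_fun setT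
    (fun w => (zeta X m w, xi X m w, ens_zeta X m w, ens_xi X m w)) by exact.
by do 3 apply: measurable_fun_pair => //.
Qed.

Let sigma_history n : sigma_algebra setT (history n).
Proof. exact: smallest_sigma_algebra. Qed.

(** The noise laws hold given the larger past that also contains the noises; integral bounds over
    its events thus apply to every smaller sigma-algebra used for conditioning. *)
Lemma natural_filtration_history n : natural_filtration (chain X) n `<=` history n.
Proof. by move=> A nA; apply: sub_sigma_algebra; left. Qed.

Lemma chain_natural_filtration n :
  g_sigma_algebra_preimage (chain X n) `<=` natural_filtration (chain X) n.
Proof. by move=> A cA; apply: sub_sigma_algebra; exists n => //=. Qed.

Let history_chain n B : measurable B -> history n (chain X n @^-1` B).
Proof.
move=> mB; apply: natural_filtration_history.
by apply: chain_natural_filtration; exists B => //; rewrite setTI.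
Qed.

Let history_signal n B : measurable B -> history n (signal X n @^-1` B).
Proof.
move=> mB; have := @history_chain n _ (measurableX mB measurableT).
by rewrite setXT.
Qed.

Let history_member n (i : 'I_K) B : measurable B ->
  history n ((fun w => col i (ensemble X n w)) @^-1` B).
Proof.
move=> mB; have mc : measurable (col i @^-1` B : set 'M[R]_(d, K)).
  by rewrite -[X in measurable X]setTI; exact: measurable_col.
have := @history_chain n _ (measurableX measurableT mc).
by rewrite setTX.
Qed.

Local Open Scope ereal_scope.

(** This law and the next three are marginals of [noise_law]: the whole space is put in all the
    other slots, where the laws have mass 1. *)
Let zeta_law n A B : history n A -> measurable B ->
  P (A `&` zeta X n.+1 @^-1` B) = \int[P]_(w in A) Q n.+1 (signal X n w) B.
Proof.
move=> hA mB.
have := @noise_law _ _ _ _ _ _ _ _ _ _ _ _ X n A B setT (fun=> setT) (fun=> setT)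
  hA mB measurableT (fun=> measurableT) (fun=> measurableT).
have -> : [set w | [/\ A w, B (zeta X n.+1 w), [set: 'cV[R]_q] (xi X n.+1 w),
    forall i : 'I_K, [set: 'cV[R]_d] (col i (ens_zeta X n.+1 w)) &
    forall i : 'I_K, [set: 'cV[R]_q] (col i (ens_xi X n.+1 w))]]
    = A `&` zeta X n.+1 @^-1` B.
  by apply/seteqP; split => [w []|w [? ?]].
move=> ->; apply: eq_integral => w _.
rewrite probability_setT mule1 !big1 ?mule1// => i _.
exact: prob_kernel.
Qed.

Let ens_zeta_law n (i : 'I_K) A B : history n A -> measurable B ->
  P (A `&` (fun w => col i (ens_zeta X n.+1 w)) @^-1` B)
  = \int[P]_(w in A) Q n.+1 (col i (ensemble X n w)) B.
Proof.
move=> hA mB; pose Bi j := if j == i then B else setT.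
have mBi j : measurable (Bi j) by rewrite /Bi; case: ifP.
have := @noise_law _ _ _ _ _ _ _ _ _ _ _ _ X n A setT setT Bi (fun=> setT)
  hA measurableT measurableT mBi (fun=> measurableT).
have -> : [set w | [/\ A w, [set: 'cV[R]_d] (zeta X n.+1 w),
    [set: 'cV[R]_q] (xi X n.+1 w), forall j, Bi j (col j (ens_zeta X n.+1 w)) &
    forall i : 'I_K, [set: 'cV[R]_q] (col i (ens_xi X n.+1 w))]]
    = A `&` (fun w => col i (ens_zeta X n.+1 w)) @^-1` B.
  apply/seteqP; split => [w [? _ _ Bw _]|w [? ?]].
    by split => //; have := Bw i; rewrite /Bi eqxx.
  by split => // j; rewrite /Bi; case: eqP => [->|].
move=> ->; apply: eq_integral => w _.
rewrite probability_setT prob_kernel !mul1e [X in _ * X]big1// ?mule1.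
rewrite (bigD1 i)//= big1 ?mule1 => [|j ji]; first by rewrite /Bi eqxx.
by rewrite /Bi (negbTE ji); exact: prob_kernel.
Qed.

Let xi_law n A B : history n A -> measurable B ->
  P (A `&` xi X n.+1 @^-1` B) = \int[P]_(w in A) nu B.
Proof.
move=> hA mB.
have := @noise_law _ _ _ _ _ _ _ _ _ _ _ _ X n A setT B (fun=> setT) (fun=> setT)
  hA measurableT mB (fun=> measurableT) (fun=> measurableT).
have -> : [set w | [/\ A w, [set: 'cV[R]_d] (zeta X n.+1 w), B (xi X n.+1 w),
    forall i : 'I_K, [set: 'cV[R]_d] (col i (ens_zeta X n.+1 w)) &
    forall i : 'I_K, [set: 'cV[R]_q] (col i (ens_xi X n.+1 w))]]
    = A `&` xi X n.+1 @^-1` B.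
  by apply/seteqP; split => [w []|w [? ?]].
move=> ->; apply: eq_integral => w _.
rewrite prob_kernel mul1e !big1 ?mule1// => i _.
  exact: probability_setT.
exact: prob_kernel.
Qed.

Let ens_xi_law n (i : 'I_K) A B : history n A -> measurable B ->
  P (A `&` (fun w => col i (ens_xi X n.+1 w)) @^-1` B) = \int[P]_(w in A) nu B.
Proof.
move=> hA mB; pose Bi j := if j == i then B else setT.
have mBi j : measurable (Bi j) by rewrite /Bi; case: ifP.
have := @noise_law _ _ _ _ _ _ _ _ _ _ _ _ X n A setT setT (fun=> setT) Bi
  hA measurableT measurableT (fun=> measurableT) mBi.
have -> : [set w | [/\ A w, [set: 'cV[R]_d] (zeta X n.+1 w),
    [set: 'cV[R]_q] (xi X n.+1 w),
    forall i : 'I_K, [set: 'cV[R]_d] (col i (ens_zeta X n.+1 w)) &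
    forall j, Bi j (col j (ens_xi X n.+1 w))]]
    = A `&` (fun w => col i (ens_xi X n.+1 w)) @^-1` B.
  apply/seteqP; split => [w [? _ _ _ Bw]|w [? ?]].
    by split => //; have := Bw i; rewrite /Bi eqxx.
  by split => // j; rewrite /Bi; case: eqP => [->|].
move=> ->; apply: eq_integral => w _.
rewrite probability_setT prob_kernel !mul1e big1 ?mul1e => [|j _]; last first.
  exact: prob_kernel.
rewrite (bigD1 i)//= big1 ?mule1 => [|j ji]; first by rewrite /Bi eqxx.
by rewrite /Bi (negbTE ji); exact: probability_setT.
Qed.

(** Stated for a general past variable [V] because the signal and each ensemble member are
    propagated by the same map and the same noise kernel. *)
Let energy_criterion_step n (V : Omega -> 'cV[R]_d)
    (z : {mfun Omega >-> 'cV[R]_d}) A :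
  (forall B, measurable B -> history n (V @^-1` B)) ->
  (forall A B, history n A -> measurable B ->
    P (A `&` z @^-1` B) = \int[P]_(w in A) Q n.+1 (V w) B) ->
  history n A ->
  \int[P]_(w in A) (sqnorm (H *m (Psi (V w) + z w)))%:E
  <= \int[P]_(w in A) ((1 - beta) * sqnorm (H *m V w) + k * 1)%:E.
Proof.
move=> hV zlaw hA.
pose f (x : 'cV[R]_d * 'cV[R]_d) := (sqnorm (H *m (Psi x.1 + x.2)))%:E.
have f0 x : 0 <= f x by rewrite lee_fin sqnorm_ge0.
have mf : measurable_fun setT f.
  apply/measurable_EFinP; apply: measurable_sqnorm_mulmx.
  by apply: measurable_cVD => //; exact: measurableT_comp.
have mV : measurable_fun setT V.
  by move=> _ B mB; rewrite setTI; apply: (@history_measurable n); exact: hV.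
have mA : measurable A by exact: history_measurable hA.
rewrite (@ge0_integral_conditional_law _ _ _ _ _ _ _ _ _ (sigma_history n)
  (@history_measurable n) (Q n.+1) V z f hV zlaw f0 mf A hA).
apply: ge0_le_integral => //.
- by move=> w _; exact: integral_ge0.
- apply: measurable_funTS.
  exact: (measurableT_comp
    (measurable_fun_integral_finite_kernel f (Q n.+1) f0 mf) mV).
- apply/measurable_funTS/measurable_EFinP/measurable_funD => //.
  by apply: measurable_funM => //; exact: measurable_sqnorm_mulmx.
- move=> w _; rewrite /f/=.
  have QT : Q n.+1 (V w) setT = 1 by exact: prob_kernel.
  rewrite (has_mean_cov_sqnorm H (Psi (V w)) QT (Q_mean_cov n.+1 (V w))).
  by rewrite lee_fin mulr1; exact: OEC.
Qed.

Let noise_step n (z : {mfun Omega >-> 'cV[R]_q}) A :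
  (forall A B, history n A -> measurable B ->
    P (A `&` z @^-1` B) = \int[P]_(w in A) nu B) ->
  history n A ->
  \int[P]_(w in A) (sqnorm (z w))%:E <= \int[P]_(w in A) (cst q%:R w)%:E.
Proof.
move=> zlaw hA.
(* The law of the observational noise does not depend on the state: it is a constant kernel over the
   signal. *)
have mnu : measurable_fun [set: 'cV[R]_d] (fun=> nu : pprobability 'cV[R]_q R).
  exact: measurable_cst.
pose f (x : 'cV[R]_d * 'cV[R]_q) := (sqnorm (1%:M *m x.2))%:E.
have f0 x : 0 <= f x by rewrite lee_fin sqnorm_ge0.
have mf : measurable_fun setT f.
  by apply/measurable_EFinP; exact: measurable_sqnorm_mulmx.
have := @ge0_integral_conditional_law _ _ _ _ _ _ _ _ _ (sigma_history n)
  (@history_measurable n) (kprobability mnu) (signal X n) z f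
  (@history_signal n) zlaw f0 mf A hA.
under eq_integral do rewrite /f/= mul1mx.
move=> ->; under eq_integral => w _.
  under eq_integral do rewrite /f/= mul1mx.
  rewrite (has_mean_cov1_sqnorm nu_mean_cov).
  over.
by [].
Qed.

Let col_mfun m p (Y : {mfun Omega >-> 'M[R]_(m, p)}) (i : 'I_p) :
    {mfun Omega >-> 'cV[R]_m} :=
  HB.pack (fun w => col i (Y w)) (isMeasurableFun.Build _ _ _ _
    (fun w => col i (Y w))
    (measurableT_comp (@measurable_col _ R m p i) (measurable_funPT Y))).

Lemma signal_energy_step n A : history n A ->
  \int[P]_(w in A) (sqnorm (H *m signal X n.+1 w))%:E
  <= \int[P]_(w in A) ((1 - beta) * sqnorm (H *m signal X n w) + k * 1)%:E.
Proof.
move=> hA; under eq_integral do rewrite signalE.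
apply: energy_criterion_step hA; first exact: history_signal.
exact: zeta_law.
Qed.

Lemma forecast_energy_step n (i : 'I_K) A : history n A ->
  \int[P]_(w in A) (sqnorm (H *m col i (forecast X n.+1 w)))%:E
  <= \int[P]_(w in A)
       ((1 - beta) * sqnorm (H *m col i (ensemble X n w)) + k * 1)%:E.
Proof.
move=> hA; under eq_integral do rewrite forecastE.
apply: (@energy_criterion_step n _ (col_mfun (ens_zeta X n.+1) i)) => //.
  exact: history_member.
exact: ens_zeta_law.
Qed.

(** * The coupled estimate for one member and the signal *)

Hypothesis psdX : psd_choice choice.

(* L is the factor of |HU|^2, |xi|^2 and |xi_k|^2 in the pointwise bound, and
   M = 2 L / beta is chosen so that (L + M) (1 - beta) <= (1 - beta / 2) M. *)
Let L : R := 3 * (1 + (beta / 2)^-1).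
Let M : R := 2 * L / beta.
(** The three summands come from the criterion applied to the forecast, from the criterion applied
    to the signal, and from the two observational noises, each of second moment tr I = q. *)
Let D : R := (1 + beta / 2) * k + (L + M) * k + 2 * L * q%:R.

Let L_gt0 : (0 < L)%R.
Proof. by rewrite mulr_gt0// addr_gt0// invr_gt0 divr_gt0. Qed.

Let M_gt0 : (0 < M)%R.
Proof. by rewrite divr_gt0// mulr_gt0. Qed.

(** The outer factors 1 give the right-hand side the shape of nested two-term combinations, ready
    for [le_integral_lincomb]. *)
Let member_pointwise n (i : 'I_K) w :
  (sqnorm (H *m col i (ensemble X n.+1 w)) + M * sqnorm (H *m signal X n.+1 w)
   <= 1 * ((1 + beta / 2) * sqnorm (H *m col i (forecast X n.+1 w))
           + (L + M) * sqnorm (H *m signal X n.+1 w))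
      + 1 * (L * sqnorm (xi X n.+1 w) + L * sqnorm (col i (ens_xi X n.+1 w))))%R.
Proof.
have pC := psdX (analysis_covP X n w).
rewrite ensembleE observationE.
have b2 : (0 < beta / 2)%R by rewrite divr_gt0.
have := analysis_sqnorm_le H (col i (forecast X n.+1 w))
  (H *m signal X n.+1 w + xi X n.+1 w + col i (ens_xi X n.+1 w)) b2 pC.
have := sqnormD3_le (H *m signal X n.+1 w) (xi X n.+1 w) (col i (ens_xi X n.+1 w)).
set s3 := sqnorm (_ + _ + _); rewrite /L; set c := ((beta / 2)^-1)%R.
have c0 : (0 < 1 + c)%R by rewrite addr_gt0// invr_gt0.
have alg (sV a u x y s b' c' M' : R) : (sV <= (1 + b') * a + (1 + c') * s ->
    (1 + c') * s <= (1 + c') * (3 * (u + x + y)) ->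
    sV + M' * u <= 1 * ((1 + b') * a + (3 * (1 + c') + M') * u)
      + 1 * (3 * (1 + c') * x + 3 * (1 + c') * y))%R.
  by lra.
rewrite -(ler_pM2l c0) => h1 h2.
exact: (alg _ _ _ _ _ _ _ _ _ h2 h1).
Qed.

Let nonneg_measurable_sqnorm q' p (A : 'M[R]_(q', p)) (Y : Omega -> 'cV[R]_p) :
  measurable_fun setT Y -> nonneg_measurable (fun w => sqnorm (A *m Y w)).
Proof.
by move=> mY; split=> [|w]; [exact: measurable_sqnorm_mulmx|exact: sqnorm_ge0].
Qed.

Let nonneg_measurable_sqnorm1 p (Y : {mfun Omega >-> 'cV[R]_p}) :
  nonneg_measurable (fun w => sqnorm (Y w)).
Proof.
have := @nonneg_measurable_sqnorm _ _ 1%:M Y (measurable_funPT Y).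
by under eq_fun do rewrite mul1mx.
Qed.

Let mcol m p (Y : {mfun Omega >-> 'M[R]_(m, p)}) (i : 'I_p) :
  measurable_fun setT (fun w => col i (Y w)).
Proof. exact: (measurable_funPT (col_mfun Y i)). Qed.

Lemma member_energy_step n (i : 'I_K) A : history n A ->
  \int[P]_(w in A) (sqnorm (H *m col i (ensemble X n.+1 w))
                    + M * sqnorm (H *m signal X n.+1 w))%:E
  <= \int[P]_(w in A) ((1 - beta / 2) * (sqnorm (H *m col i (ensemble X n w))
                                + M * sqnorm (H *m signal X n w)) + D)%:E.
Proof.
move=> hA; have mA := history_measurable hA.
have b1 : (0 <= 1 + beta / 2)%R by rewrite addr_ge0// divr_ge0 ?ltW.
have b2 : (0 <= 1 - beta / 2)%R.
  by rewrite subr_ge0 ler_pdivrMr// mul1r (le_trans (ltW beta_lt1))// ler1n.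
have b3 : (0 <= 1 - beta)%R by rewrite subr_ge0 ltW.
have LM : (0 <= L + M)%R by rewrite addr_ge0 ?ltW.
have L0 := ltW L_gt0; have M0 := ltW M_gt0; have k0 := ltW k_gt0.
have D0 : (0 <= D)%R.
  apply: addr_ge0; last by rewrite mulr_ge0// mulr_ge0.
  by apply: addr_ge0; exact: mulr_ge0.
have PV m := nonneg_measurable_sqnorm H (mcol (ensemble X m) i).
have PU m := nonneg_measurable_sqnorm H (measurable_funPT (signal X m)).
have PF := nonneg_measurable_sqnorm H (mcol (forecast X n.+1) i).
have PX := nonneg_measurable_sqnorm1 (xi X n.+1).
have PY : nonneg_measurable (fun w => sqnorm (col i (ens_xi X n.+1 w))).
  exact: (nonneg_measurable_sqnorm1 (col_mfun (ens_xi X n.+1) i)).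
have Pc c (c0 : (0 <= c)%R) := @nonneg_measurable_cst _ Omega R c c0.
have PU' : nonneg_measurable
    (fun w => (1 - beta) * sqnorm (H *m signal X n w) + k * 1)%R.
  by apply: nonneg_measurableD;
    [exact: nonneg_measurableZ|apply: Pc; rewrite mulr1].
have PV' : nonneg_measurable
    (fun w => (1 - beta) * sqnorm (H *m col i (ensemble X n w)) + k * 1)%R.
  by apply: nonneg_measurableD;
    [exact: nonneg_measurableZ|apply: Pc; rewrite mulr1].
have q0 : (0 <= q%:R :> R)%R by [].
apply: (le_trans (le_integral_EFin P mA _ _ (member_pointwise n i))).
- by apply: nonneg_measurableD => //; exact: nonneg_measurableZ.
- by apply: nonneg_measurableD; apply: nonneg_measurableZ => //;
    apply: nonneg_measurableD; exact: nonneg_measurableZ.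
(* Forecast and signal form one inner combination, the two noises the other; each of the four
   integrals is bounded separately. *)
have := le_integral_lincomb (mu := P) mA ler01 ler01
  (nonneg_measurableD (nonneg_measurableZ b1 PF) (nonneg_measurableZ LM (PU n.+1)))
  (nonneg_measurableD (nonneg_measurableZ L0 PX) (nonneg_measurableZ L0 PY))
  (nonneg_measurableD (nonneg_measurableZ b1 PV') (nonneg_measurableZ LM PU'))
  (nonneg_measurableD (nonneg_measurableZ L0 (Pc _ q0))
    (nonneg_measurableZ L0 (Pc _ q0)))
  (le_integral_lincomb mA b1 LM PF (PU n.+1) PV' PU'
     (forecast_energy_step i hA) (signal_energy_step hA))
  (le_integral_lincomb mA L0 L0 PX PY (Pc _ q0) (Pc _ q0)
     (noise_step (@xi_law n) hA)
     (@noise_step n (col_mfun (ens_xi X n.+1) i) A (@ens_xi_law n i) hA)).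
move=> /le_trans; apply; apply: le_integral_EFin => //.
- by apply: nonneg_measurableD; apply: nonneg_measurableZ => //;
    apply: nonneg_measurableD; apply: nonneg_measurableZ => //; exact: Pc.
- apply: nonneg_measurableD; last exact: Pc.
  by apply: nonneg_measurableZ => //; apply: nonneg_measurableD => //;
    exact: nonneg_measurableZ.
move=> w /=.
have := (PV n).2 w; have := (PU n).2 w.
set u := sqnorm (H *m signal _ _ _); set v := sqnorm (H *m col _ _) => u0 v0.
have bM : (beta * M = 2 * L)%R by rewrite /M; field; rewrite gt_eqF.
(* The constants cancel, and with b m = 2 l the gap is b^2 v' / 2 + b l u', which is nonnegative. *)
have alg (b v' u' k' l m q' : R) :
    (0 <= b ^+ 2 * v' -> 0 <= b * l * u' -> b * m = 2 * l ->
    1 * ((1 + b / 2) * ((1 - b) * v' + k' * 1)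
         + (l + m) * ((1 - b) * u' + k' * 1)) + 1 * (l * q' + l * q')
    <= (1 - b / 2) * (v' + m * u')
       + ((1 + b / 2) * k' + (l + m) * k' + 2 * l * q'))%R.
  move=> h1 h2 h3; rewrite -subr_ge0 [leRHS](_ : _ =
    2^-1 * (b ^+ 2 * v') + b * l * u' + (2^-1 * (b * m) - l) * u')%R; last by field.
  rewrite h3 mulKf ?subrr ?mul0r ?addr0; last by rewrite pnatr_eq0.
  by rewrite addr_ge0// mulr_ge0// invr_ge0.
apply: alg => //; first exact: mulr_ge0 (sqr_ge0 _) v0.
exact: mulr_ge0 (mulr_ge0 (ltW beta_gt0) L0) u0.
Qed.

(** * The Lyapunov property and the bound on means *)

Let contraction : (0 < 1 - beta / 2 < 1)%R.
Proof.
rewrite subr_gt0 ltr_pdivrMr// mul1r (lt_trans beta_lt1) ?ltr1n//=.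
by rewrite gtrBl divr_gt0.
Qed.

Let D_gt0 : (0 < D)%R.
Proof.
have b0 : (0 < 1 + beta / 2)%R by rewrite addr_gt0// divr_gt0.
have LM0 : (0 <= (L + M) * k)%R.
  by apply: mulr_ge0; [apply: addr_ge0; exact: ltW|exact: ltW].
have L0 : (0 <= 2 * L * q%:R)%R.
  by apply: mulr_ge0 => //; apply: mulr_ge0 => //; exact: ltW.
rewrite /D -addrA; apply: ltr_pwDl; first exact: mulr_gt0.
exact: addr_ge0.
Qed.

Let D_ge0 : (0 <= D)%R. Proof. exact: ltW. Qed.

Let KD_ge0 : (0 <= K%:R * D)%R. Proof. exact: mulr_ge0. Qed.

Let contraction_ge0 : (0 <= 1 - beta / 2)%R.
Proof. by have /andP[/ltW] := contraction. Qed.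

Let M_sqnorm_ge0 (u : 'cV[R]_q) : (0 <= M * sqnorm u)%R.
Proof. by apply: mulr_ge0; [exact: ltW|exact: sqnorm_ge0]. Qed.

(** Sharing the weight K M equally among the members makes [energy] a sum of these terms; hence the
    additive constant K D. *)
Let member (i : 'I_K) (x : 'cV[R]_d * 'M[R]_(d, K)) : R :=
  sqnorm (H *m col i x.2) + M * sqnorm (H *m x.1).

Let energyE x : @energy R d q K H M x
  = (\sum_(i < K) member i x)%R.
Proof.
rewrite big_split/= sumr_const card_ord /energy; congr (_ + _)%R.
by rewrite -(mulrA K%:R) mulr_natl.
Qed.

Let member_ge0 i x : (0 <= member i x)%R.
Proof. by apply: addr_ge0; [exact: sqnorm_ge0|exact: M_sqnorm_ge0]. Qed.

Let energy_ge0 x : (0 <= @energy R d q K H M x)%R.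
Proof.
by rewrite energyE; apply: sumr_ge0.
Qed.

Let measurable_member i : measurable_fun setT (member i).
Proof.
apply: measurable_funD.
  apply: measurable_sqnorm_mulmx.
  exact: (measurableT_comp (@measurable_col _ R d K i) measurable_snd).
by apply: measurable_funM => //; exact: measurable_sqnorm_mulmx.
Qed.

Let measurable_affine (f : 'cV[R]_d * 'M[R]_(d, K) -> R) a b :
  measurable_fun setT f -> measurable_fun setT (fun x => a * f x + b)%R.
Proof. by move=> mf; apply: measurable_funD => //; exact: measurable_funM. Qed.

Lemma energy_step n A : history n A ->
  \int[P]_(w in A) (energy H M (chain X n.+1 w))%:E
  <= \int[P]_(w in A)
       ((1 - beta / 2) * energy H M (chain X n w) + K%:R * D)%:E.
Proof.
move=> hA; have mA := history_measurable hA.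
have -> : (fun w => (energy H M (chain X n.+1 w))%:E)
    = (fun w => \sum_(i < K) (member i (chain X n.+1 w))%:E).
  by apply/funext => w; rewrite energyE sumEFin.
have -> : (fun w => ((1 - beta / 2) * energy H M (chain X n w) + K%:R * D)%:E)
    = (fun w => \sum_(i < K)
         ((1 - beta / 2) * member i (chain X n w) + D)%:E).
  apply/funext => w; rewrite energyE sumEFin; congr EFin.
  by rewrite [RHS]big_split/= -mulr_sumr sumr_const card_ord (mulr_natl D).
rewrite ge0_integral_sum//; last 2 first.
- move=> i; apply/measurable_funTS/measurable_EFinP.
  exact: (measurableT_comp (measurable_member i) (@mchain _)).
- by move=> i w _; rewrite lee_fin.
rewrite ge0_integral_sum//; last 2 first.
- move=> i; apply/measurable_funTS/measurable_EFinP.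
  exact: (measurableT_comp (measurable_affine _ _ (measurable_member i))
           (@mchain _)).
- by move=> i w _; rewrite lee_fin; apply: addr_ge0 => //; exact: mulr_ge0.
by apply: lee_sum => i _; exact: member_energy_step.
Qed.

(** [G] is left free because the bound for one member conditions on the natural filtration, while
    the Lyapunov inequality conditions on the current state alone. *)
Let cond_expectation_chain_le G n (f g : 'cV[R]_d * 'M[R]_(d, K) -> R) :
  sigma_algebra setT G -> G `<=` history n ->
  g_sigma_algebra_preimage (chain X n) `<=` G ->
  measurable_fun setT f -> measurable_fun setT g ->
  (forall x, 0 <= f x)%R -> (forall x, 0 <= g x)%R ->
  (forall A, history n A -> \int[P]_(w in A) (f (chain X n.+1 w))%:E
     <= \int[P]_(w in A) (g (chain X n w))%:E) ->
  {ae P, forall w, cond_expectation P G (fun w' => (f (chain X n.+1 w'))%:E) w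
    <= (g (chain X n w))%:E}.
Proof.
move=> sG Gh cG mf mg f0 g0 fg.
have Gm : G `<=` measurable.
  by move=> A GA; apply: (@history_measurable n); exact: Gh.
apply: (@cond_expectation_le _ _ _ P G sG Gm (f \o chain X n.+1)
  (g \o chain X n)).
- exact: (measurableT_comp mf (@mchain _)).
- by move=> w; exact: f0.
- by move=> w; exact: g0.
- move=> B mB; apply: cG; exists (g @^-1` B); last by rewrite setTI.
  by rewrite -[X in measurable X]setTI; exact: mg.
- by move=> A GA; apply: fg; exact: Gh.
Qed.

Let sigma_chain n : sigma_algebra setT (g_sigma_algebra_preimage (chain X n)).
Proof.
by apply: sigma_algebra_preimage; exact: sigma_algebra_measurable.
Qed.

Lemma enkf_lyapunov : (0 < K)%N -> lyapunov_function P (chain X) (energy H M).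
Proof.
move=> K_gt0; split; first exact: energy_ge0.
have /andP[r0 r1] := contraction.
exists (beta / 2)%R, (K%:R * D)%R; split.
- by rewrite divr_gt0//= -subr_gt0.
- by apply: mulr_gt0; rewrite ?ltr0n.
- move=> n; apply: (@cond_expectation_chain_le _ n (energy H M)
    (fun x => (1 - beta / 2) * energy H M x + K%:R * D)%R).
  + exact: sigma_chain.
  + move=> A cA; apply: natural_filtration_history.
    exact: chain_natural_filtration.
  + by [].
  + exact: measurable_energy.
  + by apply: measurable_affine; exact: measurable_energy.
  + exact: energy_ge0.
  + by move=> x; apply: addr_ge0 => //; apply: mulr_ge0.
  + exact: energy_step.
Qed.

Let historyT n : history n setT.
Proof. by rewrite -setC0; apply: sigma_algebraC; exact: sigma_algebra0. Qed.

Let mean_valueE (f : 'cV[R]_d * 'M[R]_(d, K) -> R) n :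
  mean_value P (chain X) f n = \int[P]_w (f (chain X n w))%:E.
Proof. by rewrite /mean_value unlock. Qed.

(** K D / (beta / 2) is the fixed point of x -> (1 - beta / 2) x + K D, so the induction reproduces
    it exactly. The initial mean may be infinite. *)
Lemma energy_gronwall n :
  mean_value P (chain X) (energy H M) n
  <= ((1 - beta / 2) ^+ n)%:E * mean_value P (chain X) (energy H M) 0
     + (K%:R * D / (beta / 2))%:E.
Proof.
have b2 : (0 < beta / 2)%R by rewrite divr_gt0.
have m0 m : 0 <= mean_value P (chain X) (energy H M) m.
  rewrite !mean_valueE; apply: integral_ge0 => w _.
  by rewrite lee_fin energy_ge0.
have step m : mean_value P (chain X) (energy H M) m.+1
    <= (1 - beta / 2)%:E * mean_value P (chain X) (energy H M) m
       + (K%:R * D)%:E.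
  (* With the whole space as event, the one-step bound compares means. *)
  rewrite !mean_valueE; apply: (le_trans (energy_step (@historyT m))).
  have PE : nonneg_measurable (fun w => energy H M (chain X m w)).
    split=> [|w]; last exact: energy_ge0.
    exact: (measurableT_comp (@measurable_energy R q d K H M) (@mchain _)).
  have := @integral_lincomb _ _ _ P setT (1 - beta / 2) (K%:R * D)
    _ _ measurableT contraction_ge0 KD_ge0 PE (nonneg_measurable_cst Omega ler01).
  rewrite [X in _ -> _ <= _ + X](_ : _ = (K%:R * D)%:E * \int[P]_w 1%:E).
    by under eq_integral do rewrite mulr1; move=> ->.
  have /= -> := integral_cst P measurableT 1%:E.
  by rewrite mul1e probability_setT mule1.
elim: n => [|n ih].
  by rewrite expr0 mul1e leeDl// lee_fin; apply: divr_ge0 => //; exact: ltW.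
apply: (le_trans (step n)).
apply: (@le_trans _ _ ((1 - beta / 2)%:E * (((1 - beta / 2) ^+ n)%:E
  * mean_value P (chain X) (energy H M) 0 + (K%:R * D / (beta / 2))%:E)
  + (K%:R * D)%:E)).
  by apply: leeD => //; apply: lee_wpmul2l.
rewrite ge0_muleDr; last 2 first.
- by apply: mule_ge0 => //; rewrite lee_fin; exact: exprn_ge0.
- by rewrite lee_fin; apply: divr_ge0 => //; exact: ltW.
rewrite muleA -EFinM -exprS -addeA -EFinM -EFinD leeD2l// lee_fin.
rewrite le_eqVlt; apply/orP; left; apply/eqP; field.
by rewrite gt_eqF.
Qed.

Lemma enkf_observable_stability : (0 < K)%N -> observable_stability X beta D M.
Proof.
move=> K_gt0; have /andP[r0 r1] := contraction; split.
- move=> n i.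
  apply: (@cond_expectation_chain_le _ n (member i)
    (fun x => (1 - beta / 2) * member i x + D)%R).
  + exact: smallest_sigma_algebra.
  + exact: natural_filtration_history.
  + exact: chain_natural_filtration.
  + exact: measurable_member.
  + by apply: measurable_affine; exact: measurable_member.
  + exact: member_ge0.
  + by move=> x; apply: addr_ge0 => //; exact: mulr_ge0.
  + exact: member_energy_step.
- exact: enkf_lyapunov.
- move=> m0; have m0fin : mean_value P (chain X) (energy H M) 0 \is a fin_num.
    rewrite ge0_fin_numE// !mean_valueE; apply: integral_ge0 => w _.
    by rewrite lee_fin energy_ge0.
  exists (fine (mean_value P (chain X) (energy H M) 0)
          + K%:R * D / (beta / 2))%R => n.
  apply: (le_trans (energy_gronwall n)); rewrite EFinD fineK// leeD2r//.
  rewrite -[leRHS]mul1e lee_wpmul2r//.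
    rewrite !mean_valueE; apply: integral_ge0 => w _.
    by rewrite lee_fin energy_ge0.
  by rewrite lee_fin; apply: exprn_ile1 => //; exact: ltW.
Qed.

(** * Observation of full rank *)

Variable c : R.
Hypothesis c_gt0 : (0 < c)%R.
(** Full rank enters the section through this inequality, so [q] and [d] stay distinct as matrix
    dimensions. *)
Hypothesis H_coercive : forall u : 'cV[R]_d, (sqnorm u <= c * sqnorm (H *m u))%R.

(** The sum 1 + 1/(K M) dominates both 1, for the ensemble part of the energy, and 1/(K M), which
    undoes the weight on the signal. *)
Let kappa : R := c * (1 + (K%:R * M)^-1).

Let total_square_le_energy x : (0 < K)%N ->
  (total_square x <= kappa * @energy R d q K H M x)%R.
Proof.
move=> K_gt0; have KM : (0 < K%:R * M)%R by apply: mulr_gt0; rewrite ?ltr0n.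
rewrite /total_square /energy /kappa.
set S := (\sum_(i < K) sqnorm (H *m col i x.2))%R.
have S0 : (0 <= S)%R by apply: sumr_ge0 => i _; exact: sqnorm_ge0.
apply: (@le_trans _ _ (c * (sqnorm (H *m x.1) + S))%R).
  rewrite mulrDr; apply: lerD => //.
  rewrite [(c * S)%R]mulr_sumr; apply: ler_sum => i _; exact: H_coercive.
rewrite -mulrA ler_pM2l//.
have u0 := sqnorm_ge0 (H *m x.1).
have alg (t u s : R) : (0 < t -> 0 <= u -> 0 <= s ->
    u + s <= (1 + t^-1) * (s + t * u))%R.
  move=> t0 hu hs; rewrite -subr_ge0.
  rewrite [leRHS](_ : _ = t * u + t^-1 * s)%R; last by field; rewrite gt_eqF.
  by rewrite addr_ge0 ?mulr_ge0 ?invr_ge0// ltW.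
exact: alg.
Qed.

(** The converse comparison turns a finite initial second moment into a finite initial energy. *)
Let energy_le_total_square x : (@energy R d q K H M x
  <= (1 + K%:R * M) * (d%:R * \sum_i \sum_j H i j ^+ 2) * total_square x)%R.
Proof.
rewrite /total_square /energy; set h := (d%:R * _)%R.
have h0 : (0 <= h)%R.
  rewrite mulr_ge0//; apply: sumr_ge0 => i _; apply: sumr_ge0 => j _.
  exact: sqr_ge0.
have KM0 : (0 <= K%:R * M)%R by apply: mulr_ge0 => //; exact: ltW.
set S := (\sum_(i < K) sqnorm (col i x.2))%R.
have S0 : (0 <= S)%R by apply: sumr_ge0 => i _; exact: sqnorm_ge0.
have HS : (\sum_(i < K) sqnorm (H *m col i x.2) <= h * S)%R.
  rewrite [(h * S)%R]mulr_sumr; apply: ler_sum => i _.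
  exact: sqnorm_mulmx_le.
have Hu : (K%:R * M * sqnorm (H *m x.1) <= K%:R * M * (h * sqnorm x.1))%R.
  by apply: ler_wpM2l => //; exact: sqnorm_mulmx_le.
apply: (le_trans (lerD HS Hu)).
have alg (t g s u : R) : (0 <= t -> 0 <= g -> 0 <= s -> 0 <= u ->
    g * s + t * (g * u) <= (1 + t) * g * (u + s))%R.
  move=> ht hg hs hu; rewrite -subr_ge0.
  rewrite [leRHS](_ : _ = g * u + t * g * s)%R; last by ring.
  by rewrite addr_ge0 ?mulr_ge0.
by apply: alg => //; exact: sqnorm_ge0.
Qed.

Lemma enkf_full_stability : (0 < K)%N -> full_stability X beta D M kappa.
Proof.
move=> K_gt0; have /andP[r0 r1] := contraction.
have kappa0 : (0 <= kappa)%R.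
  apply: mulr_ge0; first exact: ltW.
  by apply: addr_ge0 => //; rewrite invr_ge0; apply: mulr_ge0 => //; exact: ltW.
have total0 (x : 'cV[R]_d * 'M[R]_(d, K)) : (0 <= total_square x)%R.
  by rewrite addr_ge0 ?sqnorm_ge0// sumr_ge0// => i _; exact: sqnorm_ge0.
have mean0 n : 0 <= mean_value P (chain X) (energy H M) n.
  rewrite !mean_valueE; apply: integral_ge0 => w _.
  by rewrite lee_fin energy_ge0.
have PE n : nonneg_measurable (fun w => energy H M (chain X n w)).
  split=> [|w]; last exact: energy_ge0.
  exact: (measurableT_comp (@measurable_energy R q d K H M) (@mchain _)).
have PT n : nonneg_measurable (fun w => total_square (chain X n w)).
  split=> [|w]; last exact: total0.
  exact: (measurableT_comp (@measurable_total_square R d K) (@mchain _)).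
have meanZ a (f : 'cV[R]_d * 'M[R]_(d, K) -> R) n : (0 <= a)%R ->
    nonneg_measurable (fun w => f (chain X n w)) ->
    \int[P]_w (a * f (chain X n w))%:E = a%:E * mean_value P (chain X) f n.
  move=> a0 [mf f0]; rewrite !mean_valueE.
  under eq_integral do rewrite EFinM.
  rewrite ge0_integralZl//; first exact/measurable_EFinP.
  by move=> w _; rewrite lee_fin; exact: f0.
have bound n : mean_value P (chain X) (@total_square R d K) n
    <= kappa%:E * (((1 - beta / 2) ^+ n)%:E
                   * mean_value P (chain X) (energy H M) 0
                 + (K%:R * D / (beta / 2))%:E).
  apply: (@le_trans _ _ (kappa%:E * mean_value P (chain X) (energy H M) n)).
    rewrite -meanZ// !mean_valueE.
    apply: le_integral_EFin => //; first exact: nonneg_measurableZ.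
    by move=> w; exact: total_square_le_energy.
  by apply: lee_wpmul2l; [rewrite lee_fin|exact: energy_gronwall].
split => //.
- split; first exact: enkf_lyapunov.
  apply: (@total_square_le_compact _ _ _ _ kappa) => //.
    exact: energy_continuous.
  by move=> x; exact: total_square_le_energy.
- move=> T0.
  have m0 : mean_value P (chain X) (energy H M) 0 < +oo.
    set a := ((1 + K%:R * M) * (d%:R * \sum_i \sum_j H i j ^+ 2))%R.
    have a0 : (0 <= a)%R.
      apply: mulr_ge0.
        by apply: addr_ge0 => //; apply: mulr_ge0 => //; exact: ltW.
      apply: mulr_ge0 => //.
      by apply: sumr_ge0 => i _; apply: sumr_ge0 => j _; exact: sqr_ge0.
    apply: (@le_lt_trans _ _ (a%:E *
      mean_value P (chain X) (@total_square R d K) 0)).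
      rewrite -meanZ// !mean_valueE.
      by apply: le_integral_EFin => //; exact: nonneg_measurableZ.
    by apply: lte_mul_pinfty => //; rewrite lee_fin.
  have [_ _ /(_ m0) [B EB]] := enkf_observable_stability K_gt0.
  exists (kappa * B)%R => n.
  apply: (@le_trans _ _ (kappa%:E * mean_value P (chain X) (energy H M) n)).
    rewrite -meanZ// !mean_valueE.
    apply: le_integral_EFin => //; first exact: nonneg_measurableZ.
    by move=> w; exact: total_square_le_energy.
  by rewrite (EFinM kappa); apply: lee_wpmul2l; rewrite ?lee_fin.
Qed.

End enkf_one_step.

(** * Assembly for all choices of the analysis covariance *)

Unset Implicit Arguments.

Theorem theorem3p2 (R : realType) (h : R) (h_gt0 : 0 < h) (d q K : nat)
  (q_ge1 : (1 <= q)%N) (q_le_d : (q <= d)%N) (K_ge2 : (2 <= K)%N)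
  (H : 'M[R]_(q, d)) (rankH : \rank H = q)
  (Psi_h : {mfun 'cV[R]_d >-> 'cV[R]_d}) (R_h : 'cV[R]_d -> 'M[R]_d)
  (Q : nat -> R.-pker 'cV[R]_d ~> 'cV[R]_d)
  (Q_mean_cov : forall n u, has_mean_cov (Q n u) 0 (R_h u))
  (nu : probability 'cV[R]_q R) (nu_mean_cov : has_mean_cov nu 0 1%:M)
  (beta_h K_h : R) (beta_h_gt0 : 0 < beta_h) (beta_h_lt1 : beta_h < 1)
  (K_h_gt0 : 0 < K_h)
  (OEC : observable_energy_criterion H Psi_h R_h beta_h K_h) :
  [/\ enkf_stability H Psi_h Q nu beta_h (@sample_choice R d K),
      forall choice : cov_choice R d K, psd_choice choice ->
        enkf_stability H Psi_h Q nu beta_h choice,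
      forall lambda : R, 0 < lambda ->
        enkf_stability H Psi_h Q nu beta_h
          (@additive_inflation R d K lambda) &
      forall lambda : R, 0 < lambda ->
        enkf_stability H Psi_h Q nu beta_h
          (@uniform_inflation R d K lambda)].
Proof.
have K_gt0 : (0 < K)%N by exact: ltnW.
have psd_stable (choice : cov_choice R d K) : psd_choice choice ->
    enkf_stability H Psi_h Q nu beta_h choice.
  move=> psdC; set L : R := 3 * (1 + (beta_h / 2)^-1).
  set M := 2 * L / beta_h.
  have L_gt0 : 0 < L by rewrite mulr_gt0// addr_gt0// invr_gt0 divr_gt0.
  have M_gt0 : 0 < M by rewrite divr_gt0// mulr_gt0.
  (* The constants of the one-step estimate, fixed before any realization is introduced: they depend
     only on [beta_h], [K_h] and [q]. *)
  exists ((1 + beta_h / 2) * K_h + (L + M) * K_h + 2 * L * q%:R), M; split.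
  - rewrite -addrA; apply: ltr_pwDl.
      by apply: mulr_gt0 => //; apply: addr_gt0 => //; exact: divr_gt0.
    apply: addr_ge0; apply: mulr_ge0 => //; try exact: ltW.
      by apply: addr_ge0; exact: ltW.
    by apply: mulr_ge0 => //; exact: ltW.
  - exact: M_gt0.
  - move=> d0 Omega P X.
    exact: (enkf_observable_stability X Q_mean_cov nu_mean_cov beta_h_gt0
      beta_h_lt1 K_h_gt0 OEC psdC K_gt0).
  - move=> qd; have [c c_gt0 Hc] : exists2 c : R, 0 < c &
        forall u : 'cV[R]_d, sqnorm u <= c * sqnorm (H *m u).
      (* Here the two dimensions are identified: [H] becomes square of full rank, hence
         invertible. *)
      clear -qd rankH; subst q; exact: sqnorm_le_mulmx.
    exists (c * (1 + (K%:R * M)^-1)).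
      apply: mulr_gt0 => //; apply: addr_gt0 => //; rewrite invr_gt0.
      by apply: mulr_gt0; rewrite ?ltr0n.
    move=> d0 Omega P X.
    exact: (enkf_full_stability X Q_mean_cov nu_mean_cov beta_h_gt0
      beta_h_lt1 K_h_gt0 OEC psdC c_gt0 Hc K_gt0).
split=> [|choice|lambda l0|lambda l0].
- by apply: psd_stable => n W C ->; exact: psdmx_sample_cov.
- exact: psd_stable.
- apply: psd_stable => n W C ->; apply: psdmx_add; first exact: psdmx_sample_cov.
  by apply: psdmx_scalar; exact: ltW.
- apply: psd_stable => n W C ->; apply: psdmx_scale; last exact: psdmx_sample_cov.
  by rewrite addr_ge0// ltW.
Qed.
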